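(* Let $K$ be a field of characteristic zero, let $n\ge 0$, and let $R=K[X_0,X_1,\ldots,X_n]$ be standard graded ($\deg X_i=1$ for all $i$). Let $A_{n+1}(K)=K\langle X_0,\ldots,X_n,\partial_0,\ldots,\partial_n\rangle$ be the $(n+1)$-th Weyl algebra, graded with $\deg X_i=1$ and $\deg\partial_i=-1$. Let $M$ be a graded holonomic generalized Eulerian left $A_{n+1}(K)$-module. Then $$\chi(\partial,M)=(-1)^{n+1}\chi(X,M),$$ where $\chi(\partial,M)$ and $\chi(X,M)$ are the Euler characteristics of the de Rham homology and of the Koszul homology of $M$, respectively.
   Context: Let $\epsilon=\sum_{i=0}^n X_i\partial_i$ be the Euler operator. A graded $A_{n+1}(K)$-module $M$ is generalized Eulerian if for every homogeneous $z\in M$, of degree $|z|$, there is a positive integer $a$ (depending on $z$) with $(\epsilon-|z|)^a z=0$. For a left $A_{n+1}(K)$-module $M$, the de Rham homology $H_p(\partial,M)$ is the $p$-th homology of the Koszul (chain) complex on $M$ of the commuting $K$-linear maps $\partial=\partial_0,\ldots,\partial_n$: in homological degree $p$ it is $\bigwedge^p K^{n+1}\otimes_K M$, with differential $e_{i_1}\wedge\cdots\wedge e_{i_p}\otimes m\mapsto\sum_{k=1}^p(-1)^{k-1}e_{i_1}\wedge\cdots\widehat{e_{i_k}}\cdots\wedge e_{i_p}\otimes\partial_{i_k}m$. The Koszul homology $H_p(X,M)$ is defined in the same way using multiplication by $X=X_0,\ldots,X_n$ in place of $\partial$. When $M$ is holonomic, all these homology spaces are finite-dimensional over $K$ (known),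 and $$\chi(\partial,M)=\sum_{p=0}^{n+1}(-1)^p\dim_K H_p(\partial,M),\qquad \chi(X,M)=\sum_{p=0}^{n+1}(-1)^p\dim_K H_p(X,M).$$ The zero module is counted as holonomic. *)

(* Defs.v *)
From HB Require Import structures.
From mathcomp Require Import all_boot all_order all_algebra.
From mathcomp Require Import generic_quotient ring_quotient.
From mathcomp Require Import boolp classical_sets.
From mathcomp Require Import monalg.

Set Implicit Arguments.
Unset Strict Implicit.
Unset Printing Implicit Defensive.

Import GRing.Theory.

Local Open Scope ring_scope.
Local Open Scope quotient_scope.
Local Open Scope classical_set_scope.

(* The Weyl algebra in m variables over K is K<X_0,...,X_(m-1),d_0,...,d_(m-1)>
   modulo the two-sided ideal generated by the canonical commutation relations.
   The generator [inl i] is X_i and the generator [inr i] is d_i. *)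

Notation weyl_gen m := ('I_m + 'I_m)%type.
Notation free_alg K m := {malg K[{fmonom (weyl_gen m)}]}.

Section WeylAlgebra.
Variables (K : fieldType) (m : nat).

Local Notation FA := (free_alg K m).

Definition free_X (i : 'I_m) : FA := << fmu (inl i : weyl_gen m) >>.
Definition free_D (i : 'I_m) : FA := << fmu (inr i : weyl_gen m) >>.

Inductive weyl_rel : FA -> Prop :=
| weyl_relXX i j : weyl_rel (free_X i * free_X j - free_X j * free_X i)
| weyl_relDD i j : weyl_rel (free_D i * free_D j - free_D j * free_D i)
| weyl_relDX i j :
    weyl_rel (free_D i * free_X j - free_X j * free_D i - (i == j)%:R).

Inductive in_weyl_ideal : FA -> Prop :=
| in_weyl_ideal0 : in_weyl_ideal 0
| in_weyl_idealD a r b x : weyl_rel r -> in_weyl_ideal x ->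
    in_weyl_ideal (a * r * b + x).

Definition weyl_ideal : {pred FA} := fun x => `[< in_weyl_ideal x >].

Lemma weyl_idealP x : reflect (in_weyl_ideal x) (x \in weyl_ideal).
Proof. exact: asboolP. Qed.

Lemma weyl_ideal_zmod_closed : zmod_closed weyl_ideal.
Proof.
have addI x y : in_weyl_ideal x -> in_weyl_ideal y -> in_weyl_ideal (x + y).
  move=> Ix Iy; elim: Ix => [|a r b z rr _ IH]; first by rewrite add0r.
  by rewrite -addrA; apply: in_weyl_idealD.
have oppI x : in_weyl_ideal x -> in_weyl_ideal (- x).
  elim=> [|a r b z rr _ IH]; first by rewrite oppr0; apply: in_weyl_ideal0.
  by rewrite opprD -!mulNr; apply: in_weyl_idealD.
split; first by apply/weyl_idealP; apply: in_weyl_ideal0.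
by move=> x y /weyl_idealP Ix /weyl_idealP Iy; apply/weyl_idealP/addI/oppI.
Qed.

HB.instance Definition _ :=
  GRing.isZmodClosed.Build FA weyl_ideal weyl_ideal_zmod_closed.

Lemma weyl_idealMl a x : x \in weyl_ideal -> a * x \in weyl_ideal.
Proof.
move=> /weyl_idealP Ix; apply/weyl_idealP; elim: Ix => [|c r b z rr _ IH].
  by rewrite mulr0; apply: in_weyl_ideal0.
by rewrite mulrDr !mulrA; apply: in_weyl_idealD.
Qed.

Lemma weyl_idealMr a x : x \in weyl_ideal -> x * a \in weyl_ideal.
Proof.
move=> /weyl_idealP Ix; apply/weyl_idealP; elim: Ix => [|c r b z rr _ IH].
  by rewrite mul0r; apply: in_weyl_ideal0.
by rewrite mulrDl -(mulrA (c * r)); apply: in_weyl_idealD.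
Qed.

Definition weyl : Type := Quotient.quot weyl_ideal.
HB.instance Definition _ := Choice.on weyl.
HB.instance Definition _ := GRing.Zmodule.on weyl.

Definition weyl_proj (x : FA) : weyl := \pi_(Quotient.quot weyl_ideal) x.

Lemma weyl_projE x y : weyl_proj x = weyl_proj y <-> x - y \in weyl_ideal.
Proof.
by rewrite (Quotient.idealrBE weyl_ideal); split=> [/eqP|/eqP].
Qed.

Definition weyl_repr (x : weyl) : FA :=
  repr (x : Quotient.quot weyl_ideal).

Lemma weyl_reprK : cancel weyl_repr weyl_proj.
Proof. by move=> x; rewrite /weyl_proj reprK. Qed.

Lemma weyl_projB x y : weyl_proj (x - y) = weyl_proj x - weyl_proj y.
Proof. exact: (raddfB (\pi_(Quotient.quot weyl_ideal))). Qed.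

HB.instance Definition _ := GRing.isZmodMorphism.Build FA weyl weyl_proj
  weyl_projB.

Definition weyl_mul (x y : weyl) : weyl :=
  weyl_proj (weyl_repr x * weyl_repr y).

Lemma weyl_mulE x y : weyl_mul (weyl_proj x) (weyl_proj y) = weyl_proj (x * y).
Proof.
apply/weyl_projE.
set x' := weyl_repr _; set y' := weyl_repr _.
have -> : x' * y' - x * y = (x' - x) * y' + x * (y' - y).
  by rewrite mulrBl mulrBr addrA subrK.
apply: rpredD; [apply: weyl_idealMr|apply: weyl_idealMl];
  by apply/weyl_projE; rewrite weyl_reprK.
Qed.

Lemma weyl_mulA : associative weyl_mul.
Proof.
move=> x y z; rewrite -[x]weyl_reprK -[y]weyl_reprK -[z]weyl_reprK.
by rewrite !weyl_mulE mulrA.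
Qed.

Lemma weyl_mul1 : left_id (weyl_proj 1) weyl_mul.
Proof. by move=> x; rewrite -[x]weyl_reprK weyl_mulE mul1r. Qed.

Lemma weyl_mulr1 : right_id (weyl_proj 1) weyl_mul.
Proof. by move=> x; rewrite -[x]weyl_reprK weyl_mulE mulr1. Qed.

Lemma weyl_mulDl : left_distributive weyl_mul +%R.
Proof.
move=> x y z; rewrite -[x]weyl_reprK -[y]weyl_reprK -[z]weyl_reprK.
by rewrite -raddfD !weyl_mulE -raddfD -mulrDl.
Qed.

Lemma weyl_mulDr : right_distributive weyl_mul +%R.
Proof.
move=> x y z; rewrite -[x]weyl_reprK -[y]weyl_reprK -[z]weyl_reprK.
by rewrite -raddfD !weyl_mulE -raddfD -mulrDr.
Qed.

HB.instance Definition _ := GRing.Zmodule_isPzRing.Build weyl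
  weyl_mulA weyl_mul1 weyl_mulr1 weyl_mulDl weyl_mulDr.

Lemma weyl_proj_monoid : monoid_morphism weyl_proj.
Proof. by split=> // x y; rewrite -weyl_mulE. Qed.

HB.instance Definition _ := GRing.isMonoidMorphism.Build FA weyl weyl_proj
  weyl_proj_monoid.

Definition weyl_scale (c : K) (x : weyl) : weyl := weyl_proj c%:MP * x.

Lemma weyl_scaleA a b x :
  weyl_scale a (weyl_scale b x) = weyl_scale (a * b) x.
Proof. by rewrite /weyl_scale mulrA -rmorphM -mpolyCM. Qed.

Lemma weyl_scale1 : left_id 1 weyl_scale.
Proof. by move=> x; rewrite /weyl_scale rmorph1 mul1r. Qed.

Lemma weyl_scaleDr : right_distributive weyl_scale +%R.
Proof. by move=> a x y; rewrite /weyl_scale mulrDr. Qed.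

Lemma weyl_scaleDl x : {morph weyl_scale^~ x : a b / a + b}.
Proof. by move=> a b; rewrite /weyl_scale !raddfD mulrDl. Qed.

HB.instance Definition _ := GRing.Zmodule_isLmodule.Build K weyl
  weyl_scaleA weyl_scale1 weyl_scaleDr weyl_scaleDl.

Definition wX (i : 'I_m) : weyl := weyl_proj (free_X i).
Definition wD (i : 'I_m) : weyl := weyl_proj (free_D i).

Lemma weyl_rel_eq0 r : weyl_rel r -> weyl_proj r = 0.
Proof.
move=> rr; rewrite -(raddf0 weyl_proj); apply/weyl_projE/weyl_idealP.
rewrite subr0 -[r]addr0 -[r]mulr1 -[r * 1]mul1r mulrA.
exact: in_weyl_idealD in_weyl_ideal0.
Qed.

Lemma weyl_projM x y : weyl_proj (x * y) = weyl_proj x * weyl_proj y.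
Proof. exact: rmorphM. Qed.

Lemma wXX i j : wX i * wX j = wX j * wX i.
Proof.
apply/eqP; rewrite -subr_eq0 /wX -!weyl_projM -weyl_projB.
by rewrite weyl_rel_eq0 //; apply: weyl_relXX.
Qed.

Lemma wDD i j : wD i * wD j = wD j * wD i.
Proof.
apply/eqP; rewrite -subr_eq0 /wD -!weyl_projM -weyl_projB.
by rewrite weyl_rel_eq0 //; apply: weyl_relDD.
Qed.

Lemma wDX i j : wD i * wX j - wX j * wD i = (i == j)%:R.
Proof.
apply/eqP; rewrite -subr_eq0 /wD /wX -!weyl_projM.
rewrite -(rmorph_nat weyl_proj) -!weyl_projB.
by rewrite weyl_rel_eq0 //; apply: weyl_relDX.
Qed.

Definition euler_op : weyl := \sum_(i < m) wX i * wD i.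

End WeylAlgebra.

(* Restriction of scalars from the Weyl algebra to K. *)
Section ScalarRestriction.
Variables (K : fieldType) (m : nat) (M : lmodType (weyl K m)).

Definition as_Kspace : Type := M.
HB.instance Definition _ := GRing.Zmodule.on as_Kspace.

Definition Kscale (c : K) (x : as_Kspace) : as_Kspace :=
  weyl_proj (c%:MP : free_alg K m) *: (x : M).

Lemma KscaleA a b x : Kscale a (Kscale b x) = Kscale (a * b) x.
Proof. by rewrite /Kscale scalerA -rmorphM -mpolyCM. Qed.

Lemma Kscale1 : left_id 1 Kscale.
Proof. by move=> x; rewrite /Kscale rmorph1 scale1r. Qed.

Lemma KscaleDr : right_distributive Kscale +%R.
Proof. by move=> a x y; rewrite /Kscale scalerDr. Qed.

Lemma KscaleDl x : {morph Kscale^~ x : a b / a + b}.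
Proof. by move=> a b; rewrite /Kscale !raddfD scalerDl. Qed.

HB.instance Definition _ := GRing.Zmodule_isLmodule.Build K as_Kspace
  KscaleA Kscale1 KscaleDr KscaleDl.

End ScalarRestriction.

Section LinearAlgebra.
Variables (K : fieldType) (V : lmodType K).

Definition is_subspace (U : set V) : Prop :=
  U 0 /\ forall (c : K) (u v : V), U u -> U v -> U (c *: u + v).

Definition Kspan (S : set V) : set V :=
  [set x | exists (r : nat) (c : 'I_r -> K) (s : 'I_r -> V),
     (forall i, S (s i)) /\ x = \sum_(i < r) c i *: s i].

(* For subspaces B of Z of V: the classes of e_0, ..., e_(d-1) form a basis of
   the quotient Z/B. *)
Definition is_quot_basis (Z B : set V) (d : nat) (e : 'I_d -> V) : Prop :=
  (forall i, Z (e i)) /\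
  forall z, Z z -> exists! c : 'rV[K]_d, B (z - \sum_(i < d) c 0 i *: e i).

Definition has_quot_dim (Z B : set V) (d : nat) : Prop :=
  exists e : 'I_d -> V, is_quot_basis Z B e.

(* dim_K (Z/B), with the convention that it is 0 when Z/B is
   infinite-dimensional. *)
Definition quot_dim (Z B : set V) : nat := xget 0%N (has_quot_dim Z B).

Definition fin_dim (U : set V) : Prop := exists d, has_quot_dim U [set 0] d.

Definition Kdim (U : set V) : nat := quot_dim U [set 0].

End LinearAlgebra.

Section Filtrations.
Variables (K : fieldType) (m : nat).

Local Notation A := (weyl K m).

Definition wgen (g : weyl_gen m) : A :=
  match g with inl i => wX K i | inr i => wD K i end.

Definition wmon (w : seq (weyl_gen m)) : A := \prod_(g <- w) wgen g.

Definition wdeg (w : seq (weyl_gen m)) : int :=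
  \sum_(g <- w) match g with inl _ => 1 | inr _ => -1 end.

(* The component of degree d for deg X_i = 1, deg d_i = -1. *)
Definition weyl_homog (d : int) : set A :=
  Kspan [set a | exists2 w, wdeg w = d & a = wmon w].

(* The Bernstein filtration. *)
Definition bernstein (k : nat) : set A :=
  Kspan [set a | exists2 w, (size w <= k)%N & a = wmon w].

End Filtrations.

Section Modules.
Variables (K : fieldType) (m : nat) (M : lmodType (weyl K m)).

Local Notation A := (weyl K m).
Local Notation MK := (as_Kspace M).

(* M is the direct sum of the G j, and A_d G_j is contained in G_(d+j). *)
Record is_grading (G : int -> set MK) : Prop := IsGrading {
  grading_subspace : forall j, is_subspace (G j);
  grading_span : forall x : MK, exists (s : seq int) (c : int -> MK),
    (forall j, G j (c j)) /\ x = \sum_(j <- s) c j;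
  grading_direct : forall (s : seq int) (c : int -> MK), uniq s ->
    (forall j, G j (c j)) -> \sum_(j <- s) c j = 0 ->
    forall j, j \in s -> c j = 0;
  grading_act : forall (d j : int) (a : A) (x : M),
    weyl_homog d a -> G j x -> G (d + j) (a *: x)
}.

Definition generalized_eulerian (G : int -> set MK) : Prop :=
  forall (j : int) (z : M), G j z ->
    exists2 a : nat, (0 < a)%N & (euler_op K m - j%:~R) ^+ a *: z = 0.

Definition finitely_generated : Prop :=
  exists (r : nat) (g : 'I_r -> M),
    forall x : M, exists a : 'I_r -> A, x = \sum_(i < r) a i *: g i.

(* Good filtrations with respect to the Bernstein filtration. *)
Record good_filtration (F : nat -> set MK) : Prop := GoodFiltration {
  filtration_subspace : forall k, is_subspace (F k);
  filtration_fin_dim : forall k, fin_dim (F k);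
  filtration_incr : forall k, F k `<=` F k.+1;
  filtration_exhaust : forall x, exists k, F k x;
  filtration_act : forall (i k : nat) (a : A) (x : M),
    bernstein i a -> F k x -> F (i + k)%N (a *: x);
  filtration_good : exists k0, forall i, F (i + k0)%N `<=`
    Kspan [set y : MK | exists a : A, exists x : M,
                          [/\ bernstein i a, F k0 x & y = a *: x]]
}.

(* d is the degree of the Hilbert polynomial of a good filtration. *)
Definition has_bernstein_dim (d : nat) : Prop :=
  exists F : nat -> set MK, good_filtration F /\
  exists p : {poly rat}, size p = d.+1 /\
  exists k0, forall k, (k0 <= k)%N -> (Kdim (F k))%:R = p.[k%:R].

Definition holonomic : Prop :=
  finitely_generated /\ ((forall x : M, x = 0) \/ has_bernstein_dim m).

End Modules.

(* The Koszul complex of a_0, ..., a_(m-1) on M. A chain c stands for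
   \sum_S e_S (x) c S, where e_S = e_(i_1) /\ ... /\ e_(i_p) for
   S = {i_1 < ... < i_p}. *)
Section Koszul.
Variables (K : fieldType) (m : nat) (a : 'I_m -> weyl K m).
Variable M : lmodType (weyl K m).

Local Notation MK := (as_Kspace M).
Local Notation chain := {ffun {set 'I_m} -> MK}.

Definition elem_chain (S : {set 'I_m}) (x : MK) : chain :=
  [ffun T => if T == S then x else 0].

(* If S = {i_1 < ... < i_p} and i = i_k, then k - 1 elements of S are
   smaller than i. *)
Definition koszul_diff (c : chain) : chain :=
  \sum_(S : {set 'I_m}) \sum_(i in S)
    elem_chain (S :\ i)%SET
      ((-1 : K) ^+ #|[pred j in S | (j < i)%N]| *: (a i *: (c S : M) : MK)).

Definition chain_of_degree (p : nat) : set chain :=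
  [set c : chain | forall S : {set 'I_m}, c S != 0 -> #|S| = p].

Definition koszul_cycles (p : nat) : set chain :=
  [set c : chain | chain_of_degree p c /\ koszul_diff c = 0].

Definition koszul_boundaries (p : nat) : set chain :=
  [set c : chain | exists2 b : chain, chain_of_degree p.+1 b & c = koszul_diff b].

Definition koszul_homology_dim (p : nat) : nat :=
  quot_dim (koszul_cycles p) (koszul_boundaries p).

Definition koszul_euler_char : int :=
  \sum_(p < m.+1) (-1) ^+ p * (koszul_homology_dim p)%:Z.

End Koszul.

Definition chi_partial (K : fieldType) (m : nat) (M : lmodType (weyl K m)) :=
  koszul_euler_char (@wD K m) M.

Definition chi_X (K : fieldType) (m : nat) (M : lmodType (weyl K m)) :=
  koszul_euler_char (@wX K m) M.

(* Main.v *)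
(* On the chains e_S (x) v, let iota be the Koszul differential of the X_i, which
   lowers |S|, and let d be the operator sum_i (e_i /\ _) (x) d_i, which raises
   |S|. Up to the Hodge star, d is the Koszul differential of the d_i with degree
   p replaced by n + 1 - p, whence the sign (-1)^(n+1). The canonical
   anticommutation relations give d iota + iota d = L, where L acts on e_S (x) v
   by E + |S|, with E the Euler operator. Since M is finitely generated and
   generalized Eulerian, it has a finite filtration by submodules N_a, spanned by
   the vectors killed by the a-th power of E - c for some scalar c; on N_(a+1)/N_a
   the operator L is semisimple. As L is null-homotopic for both d and iota, the
   two complexes may be restricted to the kernel of L, where d and iota
   anticommute. For bounded graded spaces with anticommuting differentials of
   degrees 1 and -1, both having finite-dimensional homology, the two Euler
   characteristics agree. The finiteness needed for the subquotients of M follows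
   by induction on the number of operators from the bound C (k+1)^(n+1) on the
   number of independent vectors in the k-th filtration step: the kernel and the
   cokernel of one operator of a Weyl pair have growth of degree one less. *)
From HB Require Import structures.
Require Import Defs.
From mathcomp Require Import all_boot all_order all_algebra.
From mathcomp Require Import boolp classical_sets monalg.
From mathcomp Require Import zify ring.

Set Implicit Arguments.
Unset Strict Implicit.
Unset Printing Implicit Defensive.

Import Order.TTheory GRing.Theory Num.Theory.

Local Open Scope ring_scope.
Local Open Scope classical_set_scope.

(** * Dimensions of quotients of subspaces *)

(** Two obstacles shape the proof. Passing to the kernel of L need not make the terms of the
    complexes finite-dimensional, since graded components of a holonomic module can have infinite
    dimension. The Euler characteristics are therefore not compared by counting terms, but through
    [iota] acting on the homology of [d]; finiteness of the auxiliary complexes has to be proved at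
    each stage, because [quot_dim] is 0 on an infinite-dimensional quotient. Secondly, no good
    filtration is at hand for the layers N_(a+1)/N_a. An upper bound on the length of independent
    families replaces dimension theory: it passes to every subquotient with the same constant, and
    it is all that the induction on the operators consumes. Quotients are never formed: a complex
    U/W is a pair of families of subspaces of one ambient space, with relative cycles and
    boundaries. Characteristic zero serves mainly to divide by the integers coming from commutators
    such as [a, b^l] = l b^(l-1). *)

Section QuotientDimension.
Variables (K : fieldType) (V : lmodType K).
Implicit Types (U W Y Z B : set V).

Lemma subspace0 U : is_subspace U -> U 0.
Proof. by case. Qed.

Lemma subspaceD U u v : is_subspace U -> U u -> U v -> U (u + v).
Proof. by case=> _ Ul Uu Uv; rewrite -[u]scale1r; apply: Ul. Qed.

Lemma subspaceZ U a u : is_subspace U -> U u -> U (a *: u).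
Proof. by case=> U0 Ul Uu; rewrite -[_ *: _]addr0; apply: Ul. Qed.

Lemma subspaceN U u : is_subspace U -> U u -> U (- u).
Proof. by move=> sU Uu; rewrite -scaleN1r; apply: subspaceZ. Qed.

Lemma subspaceB U u v : is_subspace U -> U u -> U v -> U (u - v).
Proof. by move=> sU Uu Uv; apply: subspaceD => //; apply: subspaceN. Qed.

Lemma subspace_sum U (I : Type) (r : seq I) (P : pred I) (F : I -> V) :
  is_subspace U -> (forall i, P i -> U (F i)) -> U (\sum_(i <- r | P i) F i).
Proof.
move=> sU UF; elim/big_rec: _ => [|i x Pi Ux]; first exact: subspace0.
by apply: subspaceD => //; apply: UF.
Qed.

Lemma subspace_addKr U u v : is_subspace U -> U v -> U (u + v) -> U u.
Proof. by move=> sU Uv Uuv; rewrite -(addrK v u); apply: subspaceB. Qed.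

Lemma subspace_addKl U u v : is_subspace U -> U u -> U (u + v) -> U v.
Proof. by rewrite addrC; apply: subspace_addKr. Qed.

Lemma subspace_set0 : is_subspace [set (0 : V)].
Proof. by split=> // c u v -> ->; rewrite scaler0 addr0. Qed.

Definition sumspace U W : set V :=
  [set x | exists u w, [/\ U u, W w & x = u + w]].

Lemma sumspace_subspace U W :
  is_subspace U -> is_subspace W -> is_subspace (sumspace U W).
Proof.
move=> sU sW; split.
  by exists 0, 0; split; rewrite ?addr0; try exact: subspace0.
move=> c _ _ [u [w [Uu Ww ->]]] [u' [w' [Uu' Ww' ->]]].
exists (c *: u + u'), (c *: w + w'); split; [exact: sU.2|exact: sW.2|].
by rewrite scalerDr addrACA.
Qed.

Lemma sumspacel U W u : is_subspace W -> U u -> sumspace U W u.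
Proof. by move=> sW Uu; exists u, 0; split; rewrite ?addr0 //; apply: subspace0. Qed.

Lemma sumspacer U W w : is_subspace U -> W w -> sumspace U W w.
Proof. by move=> sU Ww; exists 0, w; split; rewrite ?add0r //; apply: subspace0. Qed.

Lemma setI_subspace U W :
  is_subspace U -> is_subspace W -> is_subspace (U `&` W).
Proof.
move=> sU sW; split; first by split; apply: subspace0.
by move=> c u v [Uu Wu] [Uv Wv]; split; [apply: sU.2|apply: sW.2].
Qed.

Definition lin_comb r (c : 'rV[K]_r) (e : 'I_r -> V) : V :=
  \sum_(i < r) c 0 i *: e i.

Lemma lin_combD r (c c' : 'rV[K]_r) e :
  lin_comb (c + c') e = lin_comb c e + lin_comb c' e.
Proof. by rewrite -big_split; apply: eq_bigr => i _; rewrite mxE scalerDl. Qed.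

Lemma lin_combZ r a (c : 'rV[K]_r) e : lin_comb (a *: c) e = a *: lin_comb c e.
Proof. by rewrite scaler_sumr; apply: eq_bigr => i _; rewrite mxE scalerA. Qed.

Lemma lin_combN r (c : 'rV[K]_r) e : lin_comb (- c) e = - lin_comb c e.
Proof. by rewrite -!scaleN1r lin_combZ. Qed.

Lemma lin_comb0 r (e : 'I_r -> V) : lin_comb 0 e = 0.
Proof. by rewrite /lin_comb big1 // => i _; rewrite mxE scale0r. Qed.

Lemma lin_combM r d (c : 'rV[K]_r) (A : 'M[K]_(r, d)) e :
  lin_comb (c *m A) e = \sum_i c 0 i *: lin_comb (row i A) e.
Proof.
under [RHS]eq_bigr do rewrite scaler_sumr.
rewrite exchange_big; apply: eq_bigr => j _; rewrite mxE scaler_suml.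
by apply: eq_bigr => i _; rewrite !mxE scalerA.
Qed.

Lemma lin_comb_in U r (c : 'rV[K]_r) e :
  is_subspace U -> (forall i, U (e i)) -> U (lin_comb c e).
Proof. by move=> sU Ue; apply: subspace_sum => // i _; apply: subspaceZ. Qed.

Definition indep_mod B r (e : 'I_r -> V) :=
  forall c : 'rV[K]_r, B (lin_comb c e) -> c = 0.

Definition spans_mod Z B r (e : 'I_r -> V) :=
  forall z, Z z -> exists c : 'rV[K]_r, B (z - lin_comb c e).

(** The coordinates of the [e i] with respect to [f] modulo [B] form an r by d matrix. If d < r, its
    left kernel contains a nonzero row, which is a relation among the [e i] modulo [B]. *)
Lemma steinitz_mod Z B r d (e : 'I_r -> V) (f : 'I_d -> V) :
  is_subspace B -> (forall i, Z (e i)) -> indep_mod B e -> spans_mod Z B f ->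
  (r <= d)%N.
Proof.
move=> sB Ze ie sf; rewrite leqNgt; apply/negP => ltdr.
have [A BA] : exists A : 'I_r -> 'rV[K]_d, forall i, B (e i - lin_comb (A i) f).
  by have /choice[A HA] := fun i => sf (e i) (Ze i); exists A.
pose M := \matrix_i A i.
have nz : kermx M != 0.
  rewrite -mxrank_eq0 mxrank_ker -lt0n subn_gt0.
  exact: leq_ltn_trans (rank_leq_col _) ltdr.
have [c cM cn0] : exists2 c : 'rV[K]_r, c *m M = 0 & c != 0.
  by exists (nz_row (kermx M)); [apply/sub_kermxP/nz_row_sub|rewrite nz_row_eq0].
case/eqP: cn0; apply: ie.
rewrite -[lin_comb c e]subr0 -[0 in X in B X](lin_comb0 f) -cM lin_combM -sumrB.
apply: subspace_sum => // i _; rewrite -scalerBr rowK.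
exact: subspaceZ.
Qed.

Lemma quot_basisI Z B d (e : 'I_d -> V) :
  is_subspace B -> (forall i, Z (e i)) -> indep_mod B e -> spans_mod Z B e ->
  has_quot_dim Z B d.
Proof.
move=> sB Ze ie se; exists e; split=> // z Zz.
have [c Bc] := se z Zz; exists c; split=> // c' Bc'.
apply/eqP; rewrite -subr_eq0; apply/eqP/ie.
have -> : lin_comb (c - c') e = (z - lin_comb c' e) - (z - lin_comb c e).
  by rewrite lin_combD lin_combN opprB [RHS]addrC addrA subrK.
exact: subspaceB.
Qed.

Lemma has_quot_dimE Z B d : is_subspace Z -> is_subspace B ->
  has_quot_dim Z B d -> exists e : 'I_d -> V,
    [/\ forall i, Z (e i), indep_mod B e & spans_mod Z B e].
Proof.
move=> sZ sB [e [Ze he]]; exists e; split=> // [c Bc|z /he[c [Bc _]]]; last by exists c.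
have [c' [_ uc']] := he _ (subspace0 sZ).
have uc x : B (lin_comb x e) -> c' = x.
  by move=> Bx; apply: uc'; rewrite sub0r; apply: subspaceN.
by rewrite -(uc c Bc) (uc 0) // lin_comb0; apply: subspace0.
Qed.

Lemma has_quot_dim_uniq Z B d d' : is_subspace Z -> is_subspace B ->
  has_quot_dim Z B d -> has_quot_dim Z B d' -> d = d'.
Proof.
move=> sZ sB /has_quot_dimE[]// e [Ze ie se] /has_quot_dimE[]// f [Zf jf sf].
apply/eqP; rewrite eqn_leq.
by rewrite (steinitz_mod sB Ze ie sf) (steinitz_mod sB Zf jf se).
Qed.

Lemma quot_dimE Z B d : is_subspace Z -> is_subspace B ->
  has_quot_dim Z B d -> quot_dim Z B = d.
Proof.
move=> sZ sB hd; apply: (has_quot_dim_uniq sZ sB) (hd).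
exact: (xgetPex 0%N (ex_intro _ d hd)).
Qed.

Definition fin_quot Z B := exists d, has_quot_dim Z B d.

Lemma fin_quotP Z B : is_subspace Z -> is_subspace B -> fin_quot Z B ->
  has_quot_dim Z B (quot_dim Z B).
Proof. by move=> sZ sB fZB; apply: (xgetPex 0%N fZB). Qed.

Definition indep_bounded Z B N := forall r (e : 'I_r -> V),
  (forall i, Z (e i)) -> indep_mod B e -> (r <= N)%N.

Lemma indep_mod_cons B r (e : 'I_r -> V) z : is_subspace B -> indep_mod B e ->
  (forall c : 'rV[K]_r, ~ B (z - lin_comb c e)) ->
  indep_mod B (fun i : 'I_r.+1 => oapp e z (unlift ord0 i)).
Proof.
move=> sB ie nz c; rewrite /lin_comb big_ord_recl unlift_none /=.
under eq_bigr do rewrite liftK /=.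
set a := c 0 ord0; pose c' := \row_j c 0 (lift ord0 j).
have -> : \sum_(i < r) c 0 (lift ord0 i) *: e i = lin_comb c' e.
  by apply: eq_bigr => i _; rewrite mxE.
have [a0|an0] := eqVneq a 0.
  rewrite a0 scale0r add0r => /ie c'0; apply/rowP => i; rewrite mxE.
  case: (unliftP ord0 i) => [j ->|->]; last exact: a0.
  by move/rowP/(_ j): c'0; rewrite !mxE.
move=> Ba; case: (nz (- a^-1 *: c')); rewrite lin_combZ scaleNr opprK.
by rewrite -[z]scale1r -(mulVf an0) -scalerA -scalerDr; apply: subspaceZ.
Qed.

(** An independent family of maximal length spans, since otherwise [indep_mod_cons] would prolong
    it. Bounding lengths is the form in which all finiteness is proved below. *)
Lemma indep_bounded_fin Z B N : is_subspace Z -> is_subspace B ->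
  indep_bounded Z B N -> fin_quot Z B.
Proof.
move=> sZ sB bN.
pose P r := `[< exists e : 'I_r -> V, (forall i, Z (e i)) /\ indep_mod B e >].
have exP : exists r, P r.
  exists 0%N; apply/asboolP; exists (fun _ => 0); split=> [[]|c _] //.
  by apply/rowP; case.
have bP r : P r -> (r <= N)%N by move=> /asboolP[e [Ze ie]]; apply: bN ie.
case: (ex_maxnP exP bP) => r /asboolP[e [Ze ie]] maxr.
exists r; apply: (quot_basisI sB Ze ie) => z Zz.
apply: contrapT => nz.
have : (r.+1 <= r)%N; last by rewrite ltnn.
apply: maxr; apply/asboolP.
exists (fun i : 'I_r.+1 => oapp e z (unlift ord0 i)); split.
  by move=> i; case: (unlift _ _) => /=.
by apply: indep_mod_cons => // c Bc; apply: nz; exists c.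
Qed.

Lemma has_quot_dim_bounded Z B d : is_subspace Z -> is_subspace B ->
  has_quot_dim Z B d -> indep_bounded Z B d.
Proof.
move=> sZ sB /has_quot_dimE[]// e [Ze ie se] r f Zf jf.
exact: steinitz_mod sB Zf jf se.
Qed.

(** [Z'/B'] is a subquotient of [Z/B]: a family in [Z'] independent modulo [B'] is also independent
    modulo [B]. *)
Lemma fin_quot_mono Z B Z' B' :
  is_subspace Z -> is_subspace B -> is_subspace Z' -> is_subspace B' ->
  Z' `<=` Z -> (forall z, Z' z -> B z -> B' z) -> fin_quot Z B -> fin_quot Z' B'.
Proof.
move=> sZ sB sZ' sB' ZZ BB [d /has_quot_dim_bounded bd].
apply: (@indep_bounded_fin _ _ d) => // r e Ze ie; apply: bd => //.
  by move=> i; apply: ZZ.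
by move=> c /BB Bc; apply: ie; apply: Bc; apply: lin_comb_in.
Qed.

Lemma has_quot_dim_add Z Y B d1 d2 :
  is_subspace Z -> is_subspace Y -> is_subspace B -> B `<=` Y -> Y `<=` Z ->
  has_quot_dim Y B d1 -> has_quot_dim Z Y d2 -> has_quot_dim Z B (d1 + d2).
Proof.
move=> sZ sY sB BY YZ /has_quot_dimE[]// e [Ye ie se].
move=> /has_quot_dimE[]// f [Zf jf sf].
pose g (k : 'I_(d1 + d2)) := match split k with inl i => e i | inr j => f j end.
have gE c : lin_comb c g = lin_comb (lsubmx c) e + lin_comb (rsubmx c) f.
  rewrite /lin_comb big_split_ord; congr (_ + _); apply: eq_bigr => i _.
    rewrite /g; case: splitP => j /= ij; last by move: (ltn_ord i); rewrite ij; lia.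
    by rewrite mxE; have -> : i = j by apply: val_inj.
  rewrite /g; case: splitP => j /= ij; first by move: (ltn_ord j); rewrite -ij; lia.
  by rewrite mxE; have -> : i = j by apply: val_inj => /=; lia.
apply: (@quot_basisI _ _ _ g) => //.
- by move=> k; rewrite /g; case: split => i //; apply: YZ.
- move=> c; rewrite gE => Bc.
  have r0 : rsubmx c = 0.
    by apply: jf; apply: (subspace_addKl sY) (BY _ Bc); apply: lin_comb_in.
  move: Bc; rewrite r0 lin_comb0 addr0 => /ie l0.
  by rewrite -(hsubmxK c) l0 r0 row_mx0.
- move=> z /sf[c2 /se[c1 Bc]]; exists (row_mx c1 c2).
  by rewrite gE row_mxKl row_mxKr opprD addrA addrAC.
Qed.

Lemma quot_dim_split Z Y B :
  is_subspace Z -> is_subspace Y -> is_subspace B -> B `<=` Y -> Y `<=` Z ->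
  fin_quot Z B ->
  [/\ fin_quot Y B, fin_quot Z Y &
      quot_dim Z B = (quot_dim Y B + quot_dim Z Y)%N].
Proof.
move=> sZ sY sB BY YZ fZB.
have fY : fin_quot Y B by apply: fin_quot_mono fZB.
have fZ : fin_quot Z Y by apply: fin_quot_mono fZB => // z _ /BY.
split=> //; apply: quot_dimE => //.
by apply: has_quot_dim_add (fin_quotP _ _ fY) (fin_quotP _ _ fZ).
Qed.

Lemma fin_quot_add Z Y B :
  is_subspace Z -> is_subspace Y -> is_subspace B -> B `<=` Y -> Y `<=` Z ->
  fin_quot Y B -> fin_quot Z Y -> fin_quot Z B.
Proof.
move=> sZ sY sB BY YZ [d1 h1] [d2 h2].
by exists (d1 + d2)%N; apply: has_quot_dim_add h1 h2.
Qed.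

Lemma spans_finType_fin Z B (I : finType) (f : I -> V) :
  is_subspace Z -> is_subspace B ->
  (forall z, Z z -> exists c : I -> K, B (z - \sum_x c x *: f x)) ->
  fin_quot Z B.
Proof.
move=> sZ sB sf; apply: (@indep_bounded_fin _ _ #|I|) => // r e Ze ie.
pose g (i : 'I_#|I|) := f (enum_val i).
apply: (steinitz_mod sB Ze ie (f := g)) => z /sf[c Bc].
exists (\row_i c (enum_val i)); move: Bc.
rewrite (reindex _ (onW_bij _ (enum_val_bij I))) /=.
rewrite (_ : \sum_j _ = lin_comb (\row_i c (enum_val i)) g) //.
by apply: eq_bigr => j _; rewrite mxE.
Qed.

Lemma has_quot_dim0 Z B : is_subspace B -> Z `<=` B -> has_quot_dim Z B 0.
Proof.
move=> sB ZB; apply: (@quot_basisI _ _ _ (fun _ => 0)) => //; first by case.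
  by move=> c _; apply/rowP; case.
by move=> z /ZB Bz; exists 0; rewrite lin_comb0 subr0.
Qed.

End QuotientDimension.

Section QuotientMaps.
Variables (K : fieldType) (V V' : lmodType K) (f : {linear V -> V'}).
Implicit Types (Z B : set V) (Y C : set V').

Lemma lin_comb_map r (c : 'rV[K]_r) (e : 'I_r -> V) :
  f (lin_comb c e) = lin_comb c (f \o e).
Proof. by rewrite linear_sum; apply: eq_bigr => i _; rewrite linearZ. Qed.

(** Families independent modulo [B] have images independent modulo [C], so a bound on lengths is
    pulled back; this is why the preimage of [C] is what has to be controlled. *)
Lemma fin_quot_inj Z B Y C :
  is_subspace Z -> is_subspace B -> is_subspace Y -> is_subspace C ->
  (forall z, Z z -> Y (f z)) -> (forall z, Z z -> C (f z) -> B z) ->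
  fin_quot Y C -> fin_quot Z B.
Proof.
move=> sZ sB sY sC fZ fB [d /has_quot_dim_bounded bd].
apply: (@indep_bounded_fin _ _ _ _ d) => // r e Ze ie.
apply: (bd _ _ r (f \o e)) => // [i|c]; first exact: fZ.
by rewrite -lin_comb_map => /fB Bc; apply: ie; apply: Bc; apply: lin_comb_in.
Qed.

Lemma has_quot_dim_iso Z B Y C d :
  is_subspace Z -> is_subspace B -> is_subspace Y -> is_subspace C ->
  (forall z, Z z -> Y (f z)) -> (forall z, Z z -> (C (f z) <-> B z)) ->
  (forall z', Y z' -> exists2 z, Z z & C (z' - f z)) ->
  has_quot_dim Z B d -> has_quot_dim Y C d.
Proof.
move=> sZ sB sY sC fZ fB fs /has_quot_dimE[]// e [Ze ie se].
apply: (@quot_basisI _ _ _ _ _ (f \o e)) => //.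
- by move=> i; apply: fZ.
- move=> c; rewrite -lin_comb_map => /fB Bc; apply: ie; apply: Bc.
  exact: lin_comb_in.
- move=> z' /fs[z Zz Cz]; have [c Bc] := se z Zz; exists c.
  have -> : z' - lin_comb c (f \o e) = (z' - f z) + f (z - lin_comb c e).
    by rewrite linearB /= lin_comb_map addrA subrK.
  apply: subspaceD => //; apply/fB => //.
  by apply: subspaceB => //; apply: lin_comb_in.
Qed.

Lemma quot_dim_iso Z B Y C :
  is_subspace Z -> is_subspace B -> is_subspace Y -> is_subspace C ->
  (forall z, Z z -> Y (f z)) -> (forall z, Z z -> (C (f z) <-> B z)) ->
  (forall z', Y z' -> exists2 z, Z z & C (z' - f z)) ->
  fin_quot Z B \/ fin_quot Y C ->
  [/\ fin_quot Z B, fin_quot Y C & quot_dim Z B = quot_dim Y C].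
Proof.
move=> sZ sB sY sC fZ fB fs fin.
have fZB : fin_quot Z B.
  by case: fin => // fin; apply: fin_quot_inj fin => // z /fB[].
have h := has_quot_dim_iso sZ sB sY sC fZ fB fs (fin_quotP sZ sB fZB).
by split=> //; [exists (quot_dim Z B)|rewrite (quot_dimE _ _ h)].
Qed.

End QuotientMaps.

(** * Relative homology of subcomplexes *)

Section Homology.
Variables (K : fieldType) (V : lmodType K) (delta : {linear V -> V}) (e : int).
Hypothesis deltaK : forall v, delta (delta v) = 0.
Implicit Types (U W : int -> set V) (p : int).

(** The degree is a mere index: the [U p] need not be independent of each other in [V], so that a
    constant family, where degrees are forgotten, is a legitimate complex. *)
Definition subcomplex U :=
  (forall p, is_subspace (U p)) /\ (forall p u, U p u -> U (p + e) (delta u)).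

Definition rel_cycles U W p : set V := [set u | U p u /\ W (p + e) (delta u)].

Definition rel_boundaries U W p : set V :=
  [set x | exists w u, [/\ W p w, U (p - e) u & x = w + delta u]].

Definition homology_fin U W p :=
  fin_quot (rel_cycles U W p) (rel_boundaries U W p).

Definition homology_dim U W p :=
  quot_dim (rel_cycles U W p) (rel_boundaries U W p).

Lemma rel_cycles_subspace U W p :
  subcomplex U -> subcomplex W -> is_subspace (rel_cycles U W p).
Proof.
move=> [sU _] [sW _]; split; first by split; rewrite ?linear0; apply: subspace0.
move=> c u v [Uu Wu] [Uv Wv]; split; first exact: (sU p).2.
by rewrite linearP; apply: (sW _).2.
Qed.

Lemma rel_boundaries_subspace U W p :
  subcomplex U -> subcomplex W -> is_subspace (rel_boundaries U W p).
Proof.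
move=> [sU _] [sW _]; split.
  by exists 0, 0; rewrite linear0 addr0; split=> //; apply: subspace0.
move=> c _ _ [w [u [Ww Uu ->]]] [w' [u' [Ww' Uu' ->]]].
exists (c *: w + w'), (c *: u + u'); split; [exact: (sW _).2|exact: (sU _).2|].
by rewrite linearP scalerDr addrACA.
Qed.

Lemma rel_boundariesW U W p w :
  subcomplex U -> W p w -> rel_boundaries U W p w.
Proof.
by move=> [sU _] Ww; exists w, 0; rewrite linear0 addr0; split=> //; apply: subspace0.
Qed.

Lemma rel_boundaries_delta U W p u :
  subcomplex W -> U p u -> rel_boundaries U W (p + e) (delta u).
Proof.
move=> [sW _] Uu; exists 0, u; rewrite add0r addrK; split=> //.
exact: subspace0.
Qed.

Lemma boundaries_sub_cycles U W p : subcomplex U -> subcomplex W ->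
  (forall q, W q `<=` U q) -> rel_boundaries U W p `<=` rel_cycles U W p.
Proof.
move=> [sU dU] [sW dW] WU _ [w [u [Ww Uu ->]]]; split.
  apply: subspaceD => //; first exact: WU.
  by rewrite -[p](subrK e); apply: dU.
by rewrite linearD deltaK addr0; apply: dW.
Qed.

Lemma second_iso (Z Y : set V) : is_subspace Z -> is_subspace Y ->
  fin_quot Z (Z `&` Y) \/ fin_quot (sumspace Z Y) Y ->
  [/\ fin_quot Z (Z `&` Y), fin_quot (sumspace Z Y) Y &
      quot_dim Z (Z `&` Y) = quot_dim (sumspace Z Y) Y].
Proof.
move=> sZ sY; apply: (@quot_dim_iso _ _ _ idfun) => //.
- exact: setI_subspace.
- exact: sumspace_subspace.
- by move=> z Zz; apply: sumspacel.
- by move=> z Zz; split=> [Yz|[]].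
- move=> _ [u [w [Zu Yw ->]]]; exists u => //=.
  by rewrite addrAC subrr add0r.
Qed.

(** * The long exact homology sequence of W in U' in U, cut into short pieces *)

Section ShortExactSequence.
Variables U U' W : int -> set V.
Hypotheses (sU : subcomplex U) (sU' : subcomplex U') (sW : subcomplex W).
Hypotheses (WU' : forall q, W q `<=` U' q) (UU' : forall q, U' q `<=` U q).

Local Notation Z := (rel_cycles U W).
Local Notation B := (rel_boundaries U W).
Local Notation Z1 := (rel_cycles U' W).
Local Notation B1 := (rel_boundaries U' W).
Local Notation Z2 := (rel_cycles U U').
Local Notation B2 := (rel_boundaries U U').

Let WU q : W q `<=` U q. Proof. by move=> x /WU'/UU'. Qed.
#[local] Hint Resolve WU : core.

Let sZ p : is_subspace (Z p). Proof. exact: rel_cycles_subspace. Qed.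
Let sB p : is_subspace (B p). Proof. exact: rel_boundaries_subspace. Qed.
Let sZ1 p : is_subspace (Z1 p). Proof. exact: rel_cycles_subspace. Qed.
Let sB1 p : is_subspace (B1 p). Proof. exact: rel_boundaries_subspace. Qed.
Let sZ2 p : is_subspace (Z2 p). Proof. exact: rel_cycles_subspace. Qed.
Let sB2 p : is_subspace (B2 p). Proof. exact: rel_boundaries_subspace. Qed.
Let BZ p : B p `<=` Z p. Proof. exact: boundaries_sub_cycles. Qed.
Let BZ1 p : B1 p `<=` Z1 p. Proof. exact: boundaries_sub_cycles. Qed.
Let BZ2 p : B2 p `<=` Z2 p. Proof. exact: boundaries_sub_cycles. Qed.

Let ZZ2 p : Z p `<=` Z2 p. Proof. by move=> u [Uu Wu]; split=> //; apply: WU'. Qed.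
Let BB2 p : B p `<=` B2 p.
Proof. by move=> _ [w [u [Ww Uu ->]]]; exists w, u; split=> //; apply: WU'. Qed.
Let Z1Z p : Z1 p `<=` Z p. Proof. by move=> u [Uu Wu]; split=> //; apply: UU'. Qed.
Let B1B p : B1 p `<=` B p.
Proof. by move=> _ [w [u [Ww Uu ->]]]; exists w, u; split=> //; apply: UU'. Qed.

(* The image of the connecting map H(U/U') -> H(U'/W). *)
Let T p := Z1 p `&` B p.
Let sT p : is_subspace (T p). Proof. exact: setI_subspace. Qed.

(** The connecting map kills exactly the classes of H(U/U') that have a representative in [Z p], so
    this is the dimension of its coimage. *)
Definition connecting_rank p := quot_dim (Z2 p) (sumspace (Z p) (B2 p)).

Let sZB2 p : is_subspace (sumspace (Z p) (B2 p)).
Proof. exact: sumspace_subspace. Qed.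

Let ZB2Z2 p : sumspace (Z p) (B2 p) `<=` Z2 p.
Proof.
move=> _ [u [w [Zu Bw ->]]].
by apply: subspaceD => //; [apply: ZZ2|apply: BZ2].
Qed.

(** On representatives the connecting map is [delta] itself. The class of [delta z] vanishes in
    H(U'/W) exactly when subtracting an element of [U'] turns [z] into a cycle of [U/W]. *)
Lemma connecting_iso p :
  fin_quot (Z2 p) (sumspace (Z p) (B2 p)) \/ fin_quot (T (p + e)) (B1 (p + e)) ->
  [/\ fin_quot (Z2 p) (sumspace (Z p) (B2 p)),
      fin_quot (T (p + e)) (B1 (p + e)) &
      connecting_rank p = quot_dim (T (p + e)) (B1 (p + e))].
Proof.
apply: (@quot_dim_iso _ _ _ delta) => //.
- move=> z [Uz U'z]; split; last exact: rel_boundaries_delta.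
  by split=> //; rewrite deltaK; apply: subspace0; apply: sW.1.
- move=> z [Uz U'z]; split.
    move=> [w [u [Ww U'u zE]]]; rewrite addrK in U'u.
    exists (z - u), u; split; last by rewrite subrK.
      split; first by apply: subspaceB (sU.1 p) _ _ => //; apply: UU'.
      by rewrite linearB zE addrK.
    exact: rel_boundariesW.
  move=> [z0 [_ [[Uz0 Wz0] [u' [u [U'u' Uu ->]]] ->]]].
  rewrite linearD [delta (u' + _)]linearD deltaK addr0.
  apply: subspaceD (sB1 _) _ _; first exact: rel_boundariesW.
  exact: rel_boundaries_delta.
- move=> t [[U't Wt] [w [u [Ww Uu tE]]]]; rewrite addrK in Uu.
  exists u; last by rewrite tE addrK; apply: rel_boundariesW.
  split=> //; apply: (subspace_addKl (sU'.1 _)) (WU' Ww) _.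
  by rewrite -tE.
Qed.

(** Exactness at H(U/W): modulo [B p], the left side is the image of H(U'/W) and the right side is
    the kernel of the map to H(U/U'). *)
Let Z1BE p : sumspace (Z1 p) (B p) = Z p `&` B2 p.
Proof.
apply/seteqP; split.
  move=> _ [u [w [Z1u Bw ->]]]; split.
    by apply: subspaceD (sZ p) _ _; [apply: Z1Z|apply: BZ].
  apply: subspaceD (sB2 p) _ _; last exact: BB2.
  by apply: rel_boundariesW => //; case: Z1u.
move=> x [[Ux Wx] [u' [u [U'u' Uu xE]]]].
exists u', (delta u); split=> //.
  by split=> //; move: Wx; rewrite xE linearD deltaK addr0.
by rewrite -[p](subrK e); apply: rel_boundaries_delta.
Qed.

Let TB p : B1 p `<=` T p. Proof. by move=> x B1x; split; [apply: BZ1|apply: B1B]. Qed.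

(** Exactness cuts each of the three homology spaces into two pieces, each shared with a neighbour
    in the sequence. This equivalence and the two below record finiteness piece by piece, so that it
    can be carried from two terms to the third. *)
Let fin_sub p : homology_fin U' W p <->
  fin_quot (T p) (B1 p) /\ fin_quot (Z p `&` B2 p) (B p).
Proof.
split=> [fh|[fT fc]].
  have [|fT fZT _] := quot_dim_split (sZ1 p) (sT p) (sB1 p) (@TB p) _ fh.
    exact: subIsetl.
  split=> //; rewrite -Z1BE.
  by have [] := second_iso (sZ1 p) (sB p) (or_introl fZT).
apply: (fin_quot_add (sZ1 p) (sT p)) fT _; [exact: sB1|exact: TB|exact: subIsetl|].
rewrite -Z1BE in fc.
by have [] := second_iso (sZ1 p) (sB p) (or_intror fc).
Qed.

Let fin_mid p : homology_fin U W p <->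
  fin_quot (Z p `&` B2 p) (B p) /\ fin_quot (sumspace (Z p) (B2 p)) (B2 p).
Proof.
have sI : is_subspace (Z p `&` B2 p) by apply: setI_subspace.
have BI : B p `<=` Z p `&` B2 p by move=> x Bx; split; [apply: BZ|apply: BB2].
split=> [fh|[fc fa]].
  have [|fc fZT _] := quot_dim_split (sZ p) sI (sB p) BI _ fh.
    exact: subIsetl.
  by split=> //; have [] := second_iso (sZ p) (sB2 p) (or_introl fZT).
apply: (fin_quot_add (sZ p) sI) fc _; [exact: sB|exact: BI|exact: subIsetl|].
by have [] := second_iso (sZ p) (sB2 p) (or_intror fa).
Qed.

Let B2ZB p : B2 p `<=` sumspace (Z p) (B2 p).
Proof. by move=> x; apply: sumspacer. Qed.

Let fin_quo p : homology_fin U U' p <->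
  fin_quot (sumspace (Z p) (B2 p)) (B2 p) /\
  fin_quot (Z2 p) (sumspace (Z p) (B2 p)).
Proof.
split=> [fh|[fa ff]].
  by have [] := quot_dim_split (sZ2 p) (sZB2 p) (sB2 p) (@B2ZB p) (@ZB2Z2 p) fh.
by apply: (fin_quot_add (sZ2 p) (sZB2 p)) fa ff.
Qed.

Lemma homology_fin_ext p :
  homology_fin U' W p -> homology_fin U U' p -> homology_fin U W p.
Proof. by move=> /fin_sub[_ fc] /fin_quo[fa _]; apply/fin_mid. Qed.

Lemma homology_fin_sub p :
  homology_fin U W p -> homology_fin U U' (p - e) -> homology_fin U' W p.
Proof.
move=> /fin_mid[fc _] /fin_quo[_ ff]; apply/fin_sub; split=> //.
by have [] := connecting_iso (or_introl ff); rewrite subrK.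
Qed.

(** Two connecting ranks occur because degree [p] is the source of one connecting map and, through
    H(U'/W), the target of the one leaving degree [p - e]. *)
Lemma homology_dim_add p :
  homology_fin U' W p -> homology_fin U U' p ->
  (homology_dim U' W p + homology_dim U U' p =
   homology_dim U W p + connecting_rank p + connecting_rank (p - e))%N.
Proof.
move=> f1 f2; have fm := homology_fin_ext f1 f2.
have [fT fc] := (fin_sub p).1 f1; have [fa ff] := (fin_quo p).1 f2.
have [|_ fZT E1] := quot_dim_split (sZ1 p) (sT p) (sB1 p) (@TB p) _ f1.
  exact: subIsetl.
have [_ _ E2] := second_iso (sZ1 p) (sB p) (or_introl fZT).
have [_ _ E3] := quot_dim_split (sZ2 p) (sZB2 p) (sB2 p) (@B2ZB p) (@ZB2Z2 p) f2.
have sI : is_subspace (Z p `&` B2 p) by apply: setI_subspace.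
have BI : B p `<=` Z p `&` B2 p by move=> x Bx; split; [apply: BZ|apply: BB2].
have [|_ fZI E4] := quot_dim_split (sZ p) sI (sB p) BI _ fm.
  exact: subIsetl.
have [_ _ E5] := second_iso (sZ p) (sB2 p) (or_introl fZI).
rewrite -[p](subrK e) in fT.
have [_ _ E6] := connecting_iso (or_intror fT); rewrite subrK in E6.
rewrite /homology_dim E1 E2 Z1BE E3 E4 E5 E6 /connecting_rank /T.
lia.
Qed.

End ShortExactSequence.

End Homology.

(** * Additivity of Euler characteristics *)

Section EulerCharacteristic.
Variables (K : fieldType) (V : lmodType K) (N : nat).
Implicit Types (U W : int -> set V) (p : int).

Definition alt_sum (h : int -> nat) : int :=
  \sum_(k < N) (-1) ^+ k * (h k%:Z)%:Z.

Lemma alt_sum_telescope_up (f : int -> nat) :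
  f 0 = 0%N -> f N%:Z = 0%N -> alt_sum (fun p => f p + f (p + 1)%R)%N = 0.
Proof.
move=> f0 fN.
suff /(_ N) : forall n, \sum_(k < n) (-1) ^+ k * ((f k%:Z + f (k%:Z + 1)%R)%N)%:Z
    = (f 0)%:Z - (-1) ^+ n * (f n%:Z)%:Z :> int.
  by rewrite f0 fN mulr0 subr0.
elim=> [|n IH]; first by rewrite big_ord0 expr0 mul1r subrr.
rewrite big_ord_recr IH /= PoszD exprS.
have -> : n%:Z + 1 = n.+1%:Z by lia.
ring.
Qed.

Lemma alt_sum_telescope_down (f : int -> nat) :
  f (-1) = 0%N -> f (N%:Z - 1) = 0%N -> alt_sum (fun p => f p + f (p - 1)%R)%N = 0.
Proof.
move=> f0 fN.
suff /(_ N) : forall n, \sum_(k < n) (-1) ^+ k * ((f k%:Z + f (k%:Z - 1)%R)%N)%:Z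
    = (f (-1))%:Z - (-1) ^+ n * (f (n%:Z - 1))%:Z :> int.
  by rewrite f0 fN mulr0 subr0.
elim=> [|n IH]; first by rewrite big_ord0 expr0 mul1r subrr.
rewrite big_ord_recr IH /= PoszD exprS.
have -> : n.+1%:Z - 1 = n%:Z by lia.
ring.
Qed.

(** Here [f p] stands for the rank of a map from degree [p] to degree [p + e], hence vanishes when
    either end is out of range. Each rank is counted in two adjacent degrees, with opposite
    signs. *)
Lemma alt_sum_telescope (e : int) (f : int -> nat) : e = 1 \/ e = -1 ->
  (forall p, ~~ (0 <= p < N%:Z) -> f p = 0%N) ->
  (forall p, ~~ (0 <= p + e < N%:Z) -> f p = 0%N) ->
  alt_sum (fun p => f p + f (p - e)%R)%N = 0.
Proof.
case=> -> f0 f1.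
  by apply: alt_sum_telescope_down; [apply: f0|apply: f1]; lia.
rewrite (_ : (fun p => _) = (fun p => f p + f (p + 1)%R)%N); last first.
  by apply: funext => p; rewrite opprK.
by apply: alt_sum_telescope_up; [apply: f1|apply: f0]; lia.
Qed.

Lemma alt_sumD f g : alt_sum (fun p => f p + g p)%N = alt_sum f + alt_sum g.
Proof. by rewrite -big_split; apply: eq_bigr => k _; rewrite PoszD mulrDr. Qed.

Lemma eq_alt_sum f g : f =1 g -> alt_sum f = alt_sum g.
Proof. by move=> fg; apply: eq_bigr => k _; rewrite fg. Qed.

Definition bounded_pair U W :=
  forall p, ~~ (0 <= p < N%:Z) -> U p `<=` W p.

Section Additivity.
Variables (delta : {linear V -> V}) (e : int).
Hypothesis deltaK : forall v, delta (delta v) = 0.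
Hypothesis e1 : e = 1 \/ e = -1.
Variables U U' W : int -> set V.
Hypotheses (sU : subcomplex delta e U) (sU' : subcomplex delta e U')
  (sW : subcomplex delta e W).
Hypotheses (WU' : forall q, W q `<=` U' q) (UU' : forall q, U' q `<=` U q).
Hypothesis bUW : bounded_pair U W.

Lemma connecting_rank0 p : ~~ (0 <= p < N%:Z) \/ ~~ (0 <= p + e < N%:Z) ->
  connecting_rank delta e U U' W p = 0%N.
Proof.
have sZ : is_subspace (rel_cycles delta e U W p) by apply: rel_cycles_subspace.
have sB : is_subspace (rel_boundaries delta e U U' p).
  exact: rel_boundaries_subspace.
move=> h; apply: quot_dimE; first exact: rel_cycles_subspace.
  exact: sumspace_subspace.
apply: has_quot_dim0; first exact: sumspace_subspace.
move=> u [Uu U'u]; case: h => h.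
  by apply: sumspacer => //; apply: rel_boundariesW => //; apply/WU'/(bUW h).
by apply: sumspacel => //; split=> //; apply: (bUW h); apply: sU.2.
Qed.

Lemma homology_euler_add :
  (forall p, homology_fin delta e U' W p) ->
  (forall p, homology_fin delta e U U' p) ->
  alt_sum (homology_dim delta e U W) =
  alt_sum (homology_dim delta e U' W) + alt_sum (homology_dim delta e U U').
Proof.
move=> f1 f2; rewrite -alt_sumD.
rewrite [RHS](eq_alt_sum (g := fun p => homology_dim delta e U W p +
   (connecting_rank delta e U U' W p + connecting_rank delta e U U' W (p - e)%R))%N).
  rewrite alt_sumD alt_sum_telescope ?addr0 // => p h; apply: connecting_rank0; auto.
by move=> p; rewrite (homology_dim_add deltaK sU sU' sW) // addnA.
Qed.

End Additivity.

Section FiniteDimensional.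
Variables (delta : {linear V -> V}) (e : int).
Hypothesis deltaK : forall v, delta (delta v) = 0.
Hypothesis e1 : e = 1 \/ e = -1.
Variables U W : int -> set V.
Hypotheses (sU : subcomplex delta e U) (sW : subcomplex delta e W).
Hypothesis WU : forall q, W q `<=` U q.
Hypothesis bUW : bounded_pair U W.
Hypothesis fUW : forall p, fin_quot (U p) (W p).

Local Notation Z := (rel_cycles delta e U W).
Local Notation B := (rel_boundaries delta e U W).

Let sZ p : is_subspace (Z p). Proof. exact: rel_cycles_subspace. Qed.
Let sB p : is_subspace (B p). Proof. exact: rel_boundaries_subspace. Qed.
Let BZ p : B p `<=` Z p. Proof. exact: boundaries_sub_cycles. Qed.
Let ZU p : Z p `<=` U p. Proof. by move=> u []. Qed.
Let WB p : W p `<=` B p. Proof. by move=> u; apply: rel_boundariesW. Qed.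
Let WZ p : W p `<=` Z p. Proof. by move=> u /WB/BZ. Qed.

Lemma finite_homology_fin p : homology_fin delta e U W p.
Proof.
apply: fin_quot_mono (fUW p); [exact: sU.1|exact: sW.1|exact: sZ|exact: sB|exact: ZU|].
by move=> z _ /WB.
Qed.

Lemma finite_euler :
  alt_sum (homology_dim delta e U W) = alt_sum (fun p => quot_dim (U p) (W p)).
Proof.
(* [g p] is the rank of the differential leaving degree [p], since [delta] identifies [U/Z] with
   [B/W] one step further. *)
pose g p := quot_dim (U p) (Z p).
have fUZ p : fin_quot (U p) (Z p).
  by have [] := quot_dim_split (sU.1 p) (sZ p) (sW.1 p) (@WZ p) (@ZU p) (fUW p).
have gE p : g p = quot_dim (B (p + e)) (W (p + e)).
  have [||||_ _ //] := @quot_dim_iso _ _ _ delta (U p) (Z p) (B (p + e))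
    (W (p + e)) (sU.1 p) (sZ p) (sB _) (sW.1 _).
  - by move=> z Uz; apply: rel_boundaries_delta.
  - by move=> z Uz; split=> [Wz|[]].
  - move=> _ [w [u [Ww Uu ->]]]; rewrite addrK in Uu.
    by exists u; rewrite ?addrK.
  - by left.
rewrite [RHS](eq_alt_sum (g := fun p =>
   homology_dim delta e U W p + (g p + g (p - e)%R))%N).
  rewrite alt_sumD alt_sum_telescope ?addr0 // => p h; apply: quot_dimE;
    rewrite /g //; try exact: sU.1; apply: has_quot_dim0 => // u Uu.
    by apply: WZ; apply: bUW h _ Uu.
  by split=> //; apply: (bUW h); apply: sU.2.
move=> p.
have [fZW _ ->] := quot_dim_split (sU.1 p) (sZ p) (sW.1 p) (@WZ p) (@ZU p) (fUW p).
have [_ _ ->] := quot_dim_split (sZ p) (sB p) (sW.1 p) (@WB p) (@BZ p) fZW.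
rewrite (gE (p - e)) subrK /g /homology_dim; lia.
Qed.

End FiniteDimensional.

End EulerCharacteristic.

(** * Two anticommuting differentials of opposite degrees *)

Section AnticommutingDifferentials.
Variables (K : fieldType) (V : lmodType K) (N : nat).
Variables (d iota : {linear V -> V}).
Hypothesis dK : forall v, d (d v) = 0.
Hypothesis iotaK : forall v, iota (iota v) = 0.
Variables U W : int -> set V.
Hypotheses (dU : subcomplex d 1 U) (dW : subcomplex d 1 W).
Hypotheses (iU : subcomplex iota (-1) U) (iW : subcomplex iota (-1) W).
Hypothesis WU : forall q, W q `<=` U q.
Hypothesis bUW : bounded_pair N U W.
Hypothesis anticomm : forall p u, U p u -> W p (d (iota u) + iota (d u)).
Hypothesis fin_d : forall p, homology_fin d 1 U W p.
Hypothesis fin_iota : forall p, homology_fin iota (-1) U W p.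

Local Notation Z := (rel_cycles d 1 U W).
Local Notation B := (rel_boundaries d 1 U W).

Let sU p : is_subspace (U p). Proof. exact: dU.1. Qed.
Let sW p : is_subspace (W p). Proof. exact: dW.1. Qed.
Let sZ p : is_subspace (Z p). Proof. exact: rel_cycles_subspace. Qed.
Let sB p : is_subspace (B p). Proof. exact: rel_boundaries_subspace. Qed.
Let BZ p : B p `<=` Z p. Proof. exact: boundaries_sub_cycles. Qed.
Let ZU p : Z p `<=` U p. Proof. by move=> u []. Qed.
Let WB p : W p `<=` B p. Proof. by move=> u; apply: rel_boundariesW. Qed.

Let d_iota p u : U p u -> W p (iota (d u)) -> W p (d (iota u)).
Proof. by move=> /anticomm Lu Wu; apply: subspace_addKr Lu. Qed.

Let iota_d p u : U p u -> W p (d (iota u)) -> W p (iota (d u)).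
Proof. by move=> /anticomm Lu Wu; apply: subspace_addKl Lu. Qed.

Let iZ : subcomplex iota (-1) Z.
Proof.
split=> // p u [Uu Wu]; split; first exact: iU.2.
rewrite subrK; apply: d_iota => //.
by rewrite -[p](addrK 1); apply: iW.2.
Qed.

Let iB : subcomplex iota (-1) B.
Proof.
split=> // p _ [w [u [Ww Uu ->]]].
(* [iota (d u)] equals [d (- iota u)] up to the anticommutator, which lies in [W]. *)
exists (iota w + (d (iota u) + iota (d u))), (- iota u); split.
- apply: subspaceD => //; first exact: iW.2.
  exact: anticomm.
- by apply: subspaceN => //; apply: iU.2.
- by rewrite linearN linearD /= -addrA; congr (_ + _); rewrite addrAC subrr add0r.
Qed.

Let sc p : is_subspace (rel_cycles iota (-1) U Z p).
Proof. exact: rel_cycles_subspace. Qed.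
Let sb p : is_subspace (rel_boundaries iota (-1) U Z p).
Proof. exact: rel_boundaries_subspace. Qed.
Let sc' p : is_subspace (rel_cycles iota (-1) B W p).
Proof. exact: rel_cycles_subspace. Qed.
Let sb' p : is_subspace (rel_boundaries iota (-1) B W p).
Proof. exact: rel_boundaries_subspace. Qed.

(* The differential d induces an isomorphism of U/Z onto B/W, shifting degrees by one. *)
Let shift_iso p :
  homology_fin iota (-1) U Z p \/ homology_fin iota (-1) B W (p + 1) ->
  [/\ homology_fin iota (-1) U Z p, homology_fin iota (-1) B W (p + 1) &
      homology_dim iota (-1) U Z p = homology_dim iota (-1) B W (p + 1)].
Proof.
apply: (@quot_dim_iso _ _ _ d) => //.
- move=> u [Uu [_ Wu]]; rewrite subrK in Wu; split.
    exact: rel_boundaries_delta.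
  by rewrite addrK; apply: iota_d.
- move=> z [Uz _]; split.
    move=> [w [x [Ww [w' [u' [Ww' Uu' ->]]] zE]]].
    rewrite opprK in Ww'; rewrite opprK addrK in Uu'.
    (* Since [d z = w + iota (w' + d u')], applying [d] to [z + iota u'] leaves only terms of [W]
       and an anticommutator. Thus [z] is a [d]-cycle up to an [iota]-boundary. *)
    exists (z + iota u'), (- u'); split; last by rewrite linearN addrK.
      split; first by apply: subspaceD => //; rewrite -[p](addrK 1); apply: iU.2.
      have -> : d (z + iota u') = w + iota w' + (d (iota u') + iota (d u')).
        by rewrite linearD /= zE linearD /= -!addrA [iota (d _) + _]addrC.
      apply: subspaceD => //; last exact: anticomm.
      by apply: subspaceD => //; rewrite -[p + 1](addrK 1); apply: iW.2.
    by apply: subspaceN => //; rewrite opprK.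
  move=> [k [u' [[Uk Wk] Uu' ->]]]; rewrite opprK in Uu'.
  exists (d k + (d (iota u') + iota (d u'))), (d (- u')); split.
  + by apply: subspaceD => //; apply: anticomm.
  + by rewrite opprK; apply: rel_boundaries_delta => //; apply: subspaceN.
  + by rewrite !linearN linearD /= addrA addrK.
- move=> x [[w [u [Ww Uu ->]]] Wx]; rewrite addrK in Uu Wx.
  exists u; last by rewrite addrK; apply: rel_boundariesW.
  split=> //; split; first exact: iU.2.
  rewrite subrK; apply: d_iota => //.
  move: Wx; rewrite linearD; apply: subspace_addKl => //.
  by rewrite -[p](addrK 1); apply: iW.2.
Qed.

Let fin_ZB p : fin_quot (Z p) (B p). Proof. exact: fin_d. Qed.

Let B0 p : ~~ (0 <= p < N%:Z) -> has_quot_dim (rel_cycles iota (-1) B W p)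
  (rel_boundaries iota (-1) B W p) 0.
Proof.
move=> h; apply: has_quot_dim0 => // u [Bu _].
apply: rel_boundariesW => //.
apply: (bUW h).
by apply: ZU; apply: BZ.
Qed.

Let BU p : B p `<=` U p. Proof. by move=> u /BZ/ZU. Qed.
Let WZ p : W p `<=` Z p. Proof. by move=> u /WB/BZ. Qed.

Let fin_ZB_homology p : homology_fin iota (-1) Z B p.
Proof. exact: finite_homology_fin. Qed.

(* Finiteness in degree p follows from degree p + 2, so that boundedness makes a
   descending induction possible. *)
Let fin_step p : homology_fin iota (-1) B W (p + 1 + 1) ->
  homology_fin iota (-1) B W p.
Proof.
move=> f2; have [f1 _ _] := shift_iso (or_intror f2).
have fZ : homology_fin iota (-1) Z W p.
  by apply: (homology_fin_sub iotaK iU iZ iW) => //; rewrite opprK.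
exact: (homology_fin_sub iotaK iZ iB iW).
Qed.

Let fin_B p : homology_fin iota (-1) B W p.
Proof.
have [/B0 h|Np] := boolP (~~ (0 <= p < N%:Z)); first by exists 0%N.
(* Two consecutive degrees are carried along because [fin_step] descends by two. *)
suff h : forall k : nat, homology_fin iota (-1) B W (N%:Z - k%:Z) /\
    homology_fin iota (-1) B W (N%:Z - k%:Z + 1).
  have -> : p = N%:Z - `|N%:Z - p|%N%:Z by lia.
  exact: (h _).1.
elim=> [|k [IH1 IH2]].
  by split; exists 0%N; apply: B0; lia.
have e1 : N%:Z - k.+1%:Z + 1 = N%:Z - k%:Z by lia.
by rewrite e1; split=> //; apply: fin_step; rewrite e1.
Qed.

Let fin_UZ p : homology_fin iota (-1) U Z p.
Proof. by have [] := shift_iso (or_intror (fin_B (p + 1))). Qed.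

Let fin_Z p : homology_fin iota (-1) Z W p.
Proof. exact: (homology_fin_ext iotaK iZ iB iW). Qed.

(* With Z and B the cycles and boundaries of d, the iota-homologies of U/Z and of
   B/W cancel, and what remains is the finite-dimensional complex Z/B with differential
   iota, whose terms are the homology spaces of d. *)
Lemma anticommuting_euler :
  alt_sum N (homology_dim iota (-1) U W) = alt_sum N (homology_dim d 1 U W).
Proof.
have e1 : (-1 : int) = 1 \/ (-1 : int) = -1 by right.
have bZW : bounded_pair N Z W by move=> p h u /ZU/(bUW h).
have bZB : bounded_pair N Z B by move=> p h u /bZW Wu; apply/WB/Wu.
rewrite (homology_euler_add iotaK e1 iU iZ iW) // (homology_euler_add iotaK e1 iZ iB iW) //.
rewrite (finite_euler iotaK e1 iZ iB) // addrAC -alt_sumD.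
rewrite (eq_alt_sum N (g := fun p => homology_dim iota (-1) B W p +
   homology_dim iota (-1) B W (p + 1)%R)%N) ?alt_sum_telescope_up ?add0r //.
(* In degree 0 the boundaries come from degree -1, where [U] is contained in [W]; so the telescoping
   sum has no initial term. *)
- by apply: quot_dimE => //; apply: has_quot_dim0 => // u [[w [x [Ww Ux ->]]] _];
    apply: rel_boundariesW => //; apply: subspaceD => //; rewrite -[0](subrK 1);
    apply: dW.2; apply: bUW Ux; lia.
- by apply: quot_dimE => //; apply: B0; lia.
- by move=> p; have [_ _ ->] := shift_iso (or_intror (fin_B (p + 1))).
Qed.

End AnticommutingDifferentials.

(* Up to homotopy, L acts by zero on the homology of U/W, so that only its kernel matters. *)
Section HomotopyKernel.
Variables (K : fieldType) (V : lmodType K) (N : nat).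
Variables (delta delta' : {linear V -> V}) (e : int) (L : V -> V).
Hypothesis deltaK : forall v, delta (delta v) = 0.
Hypothesis delta'K : forall v, delta' (delta' v) = 0.
Hypothesis e1 : e = 1 \/ e = -1.
Hypothesis LE : forall v, L v = delta (delta' v) + delta' (delta v).
Variables U W : int -> set V.
Hypotheses (sU : subcomplex delta e U) (sW : subcomplex delta e W).
Hypotheses (sU' : subcomplex delta' (- e) U) (sW' : subcomplex delta' (- e) W).
Hypothesis WU : forall q, W q `<=` U q.
Hypothesis bUW : bounded_pair N U W.
Hypothesis U_decomp : forall p u, U p u ->
  exists u0 v, [/\ U p u0, W p (L u0), U p v & u = u0 + L v].
Hypothesis L_reduced : forall p u, U p u -> W p (L (L u)) -> W p (L u).
Hypothesis fin_delta : forall p, homology_fin delta e U W p.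

Definition kernel_mod (p : int) : set V := [set u | U p u /\ W p (L u)].

Let LD u v : L (u + v) = L u + L v.
Proof. by rewrite !LE !linearD /= addrACA. Qed.

Let L_delta v : L (delta v) = delta (L v).
Proof. by rewrite !LE linearD /= !deltaK linear0 addr0 add0r. Qed.

Let L_delta' v : L (delta' v) = delta' (L v).
Proof. by rewrite !LE linearD /= !delta'K linear0 addr0 add0r. Qed.

Lemma kernel_mod_subcomplex : subcomplex delta e kernel_mod.
Proof.
split=> [p|p u [Uu Wu]]; last by split; [apply: sU.2|rewrite L_delta; apply: sW.2].
split; first by split; rewrite ?LE ?linear0 ?addr0; apply: subspace0; [apply: sU.1|apply: sW.1].
move=> c u v [Uu Wu] [Uv Wv]; split; first by apply: (sU.1 p).2.
rewrite LE !linearP /= addrACA -scalerDr -!LE.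
exact: (sW.1 p).2.
Qed.

Let W_kernel p : W p `<=` kernel_mod p.
Proof.
move=> w Ww; split; first exact: WU.
rewrite LE; apply: subspaceD (sW.1 p) _ _.
  by rewrite -[p](subrK e); apply: sW.2; apply: sW'.2.
by rewrite -[p](addrK e); apply: sW'.2; apply: sW.2.
Qed.

(** On [U/kernel_mod] the map [L] is surjective by [U_decomp] and injective by [L_reduced]. Being
    also null-homotopic, it acts on homology both bijectively and by zero. *)
Let quotient_acyclic p : has_quot_dim (rel_cycles delta e U kernel_mod p)
  (rel_boundaries delta e U kernel_mod p) 0.
Proof.
have sk := kernel_mod_subcomplex.
apply: has_quot_dim0; first exact: rel_boundaries_subspace.
move=> u [Uu [_ Wu]]; have [u0 [v [Uu0 Wu0 Uv uE]]] := U_decomp Uu.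
(* As [L] commutes with [delta], the vector [delta v] is killed by the square of [L] modulo [W], and
   [L_reduced] removes one factor. This puts the term [delta' (delta v)] of [L v] into the kernel
   and leaves the boundary [delta (delta' v)]. *)
have Wdv : W (p + e) (L (delta v)).
  apply: L_reduced; first exact: sU.2.
  have -> : L (L (delta v)) = L (delta u) - delta (L u0).
    by rewrite !L_delta uE LD linearD addrAC subrr add0r.
  by apply: subspaceB (sW.1 _) Wu _; apply: sW.2.
exists (u0 + delta' (delta v)), (delta' v); split; last first.
- by rewrite {1}uE LE -addrA [delta' _ + _]addrC.
- exact: sU'.2.
split.
  by apply: subspaceD (sU.1 p) Uu0 _; rewrite -[p](addrK e); apply: sU'.2; apply: sU.2.
rewrite LD L_delta'; apply: subspaceD (sW.1 p) Wu0 _.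
by rewrite -[p](addrK e); apply: sW'.2.
Qed.

Lemma kernel_mod_fin p : homology_fin delta e kernel_mod W p.
Proof.
apply: (homology_fin_sub deltaK sU kernel_mod_subcomplex sW) => //.
  by move=> q u [].
by exists 0%N.
Qed.

Lemma kernel_mod_euler :
  alt_sum N (homology_dim delta e kernel_mod W) =
  alt_sum N (homology_dim delta e U W).
Proof.
have sk := kernel_mod_subcomplex.
rewrite (homology_euler_add deltaK e1 sU sk sW) //.
- rewrite [X in _ + X]big1 ?addr0 // => k _.
  have -> : homology_dim delta e U kernel_mod k = 0%N.
    by apply: quot_dimE (quotient_acyclic k);
      [apply: rel_cycles_subspace|apply: rel_boundaries_subspace].
  by rewrite mulr0.
- by move=> q u [].
- exact: kernel_mod_fin.
- by exists 0%N.
Qed.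

End HomotopyKernel.

Section EulerComparison.
Variables (K : fieldType) (V : lmodType K) (N : nat).
Variables (d iota : {linear V -> V}) (L : V -> V).
Hypothesis dK : forall v, d (d v) = 0.
Hypothesis iotaK : forall v, iota (iota v) = 0.
Hypothesis LE : forall v, L v = d (iota v) + iota (d v).
Variables U W : int -> set V.
Hypotheses (dU : subcomplex d 1 U) (dW : subcomplex d 1 W).
Hypotheses (iU : subcomplex iota (-1) U) (iW : subcomplex iota (-1) W).
Hypothesis WU : forall q, W q `<=` U q.
Hypothesis bUW : bounded_pair N U W.
Hypothesis U_decomp : forall p u, U p u ->
  exists u0 v, [/\ U p u0, W p (L u0), U p v & u = u0 + L v].
Hypothesis L_reduced : forall p u, U p u -> W p (L (L u)) -> W p (L u).
Hypothesis fin_d : forall p, homology_fin d 1 U W p.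
Hypothesis fin_iota : forall p, homology_fin iota (-1) U W p.

Lemma homotopy_euler :
  alt_sum N (homology_dim iota (-1) U W) = alt_sum N (homology_dim d 1 U W).
Proof.
have LE' v : L v = iota (d v) + d (iota v) by rewrite LE addrC.
have e1 : (-1 : int) = 1 \/ (-1 : int) = -1 by right.
have e2 : (1 : int) = 1 \/ (1 : int) = -1 by left.
have dU' : subcomplex d (- -1) U by rewrite opprK.
have dW' : subcomplex d (- -1) W by rewrite opprK.
rewrite -(kernel_mod_euler iotaK dK e1 LE' iU iW dU' dW') //.
rewrite -(kernel_mod_euler dK iotaK e2 LE dU dW iU iW) //.
apply: anticommuting_euler => //.
- exact: (kernel_mod_subcomplex dK LE dU dW).
- exact: (kernel_mod_subcomplex iotaK LE' iU iW).
- move=> p w Ww; split; first exact: WU.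
  rewrite LE; apply: subspaceD (dW.1 p) _ _.
    by rewrite -[p](subrK 1); apply: dW.2; apply: iW.2.
  by rewrite -[p](addrK 1); apply: iW.2; apply: dW.2.
- by move=> p h u [Uu _]; apply: bUW h _ Uu.
- by move=> p u []; rewrite LE.
- by move=> p; apply: (kernel_mod_fin dK iotaK LE dU dW iU iW).
- by move=> p; apply: (kernel_mod_fin iotaK dK LE' iU iW dU' dW').
Qed.

End EulerComparison.

(** * Koszul complexes *)

Section KoszulOperators.
Variables (K : fieldType) (V : lmodType K) (m : nat).
Hypothesis charK0 : [pchar K] =i pred0.
Local Notation chain := {ffun {set 'I_m} -> V}.
Implicit Types (i j : 'I_m) (S T : {set 'I_m}) (c : chain).

Definition koszul_sign i T : K := (-1) ^+ #|[pred j in T | (j < i)%N]|.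

Lemma koszul_signM i T : koszul_sign i T * koszul_sign i T = 1.
Proof. by rewrite /koszul_sign -exprD addnn -signr_odd odd_double. Qed.

Lemma koszul_sign_add i j T : i \notin T ->
  koszul_sign j (i |: T)%SET = (-1) ^+ (i < j)%N * koszul_sign j T.
Proof.
move=> iT; rewrite /koszul_sign -exprD; congr (_ ^+ _).
rewrite (cardD1 i) inE /= setU11 /=; congr (_ + _)%N; apply: eq_card => k.
by rewrite !inE; have [->|] := eqVneq k i; rewrite ?(negbTE iT).
Qed.

Lemma koszul_sign_del i j T : i \in T ->
  koszul_sign j (T :\ i)%SET = (-1) ^+ (i < j)%N * koszul_sign j T.
Proof.
move=> iT; rewrite -{2}(finset.setD1K iT) koszul_sign_add ?setD11 //.
by rewrite mulrA -exprD addnn -signr_odd odd_double mul1r.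
Qed.

(** Interior product, described by the coefficient at the target set [T], to which only [i |: T]
    contributes. The sign may be read off at [T], because [i] is not counted among the indices below
    [i]. *)
Definition contract i c : chain :=
  [ffun T : {set 'I_m} => if i \in T then 0 else koszul_sign i T *: c (i |: T)%SET].

Definition wedge i c : chain :=
  [ffun T : {set 'I_m} => if i \in T then koszul_sign i T *: c (T :\ i)%SET else 0].

Definition chain_map (f : V -> V) c : chain := [ffun T : {set 'I_m} => f (c T)].

Lemma contract_linear i : linear (contract i).
Proof.
move=> a c c'; apply/ffunP => T; rewrite !ffunE; case: ifP => _.
  by rewrite scaler0 addr0.
by rewrite scalerDr !scalerA mulrC.
Qed.

HB.instance Definition _ i :=
  GRing.isLinear.Build K chain chain _ (contract i) (contract_linear i).

Lemma wedge_linear i : linear (wedge i).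
Proof.
move=> a c c'; apply/ffunP => T; rewrite !ffunE; case: ifP => _.
  by rewrite scalerDr !scalerA mulrC.
by rewrite scaler0 addr0.
Qed.

HB.instance Definition _ i :=
  GRing.isLinear.Build K chain chain _ (wedge i) (wedge_linear i).

Lemma chain_map_linear (f : {linear V -> V}) : linear (chain_map f).
Proof. by move=> a c c'; apply/ffunP => T; rewrite !ffunE linearP. Qed.

HB.instance Definition _ (f : {linear V -> V}) :=
  GRing.isLinear.Build K chain chain _ (chain_map f) (chain_map_linear f).

Lemma ltn_swap_sign i j : i != j -> (-1) ^+ (i < j)%N = - (-1) ^+ (j < i)%N :> K.
Proof. by rewrite -val_eqE /=; case: ltngtP => //= _ _; rewrite ?opprK. Qed.

Lemma contract_contract i j c :
  contract i (contract j c) = - contract j (contract i c).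
Proof.
apply/ffunP => T; rewrite !ffunE !in_setU1.
have [<-|ij] := eqVneq i j; first by rewrite /= scaler0 if_same oppr0.
rewrite /=.
case: ifPn => iT; case: ifPn => jT; rewrite ?scaler0 ?oppr0 //.
rewrite !scalerA -scaleNr finset.setUCA; congr (_ *: _).
by rewrite !koszul_sign_add // (ltn_swap_sign ij); ring.
Qed.

Lemma wedge_wedge i j c : wedge i (wedge j c) = - wedge j (wedge i c).
Proof.
apply/ffunP => T; rewrite !ffunE !in_setD1.
have [<-|ij] := eqVneq i j; first by rewrite /= scaler0 if_same oppr0.
rewrite /=.
case: ifPn => iT; case: ifPn => jT; rewrite ?scaler0 ?oppr0 //.
rewrite !scalerA -scaleNr; congr (_ *: c _); last first.
  by apply/setP => k; rewrite !inE andbCA.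
by rewrite !koszul_sign_del // (ltn_swap_sign ij); ring.
Qed.

Lemma contract_wedge i j c :
  contract i (wedge j c) + wedge j (contract i c) = (i == j)%:R *: c.
Proof.
apply/ffunP => T; rewrite !ffunE !in_setU1 !in_setD1.
have [<-|ij] := eqVneq i j.
  rewrite /= scale1r; case: ifPn => iT; rewrite ?addr0 ?add0r scalerA.
    by rewrite finset.setD1K // koszul_sign_del // ltnn mul1r koszul_signM scale1r.
  by rewrite finset.setU1K // koszul_sign_add // ltnn mul1r koszul_signM scale1r.
rewrite /= scale0r.
case: ifPn => iT; case: ifPn => jT; rewrite ?scaler0 ?addr0 //.
have -> : ((i |: T) :\ j = i |: (T :\ j))%SET.
  apply/setP => k; rewrite !inE; have [->|//] := eqVneq k j.
  by rewrite eq_sym (negbTE ij).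
rewrite !scalerA -scalerDl koszul_sign_add // koszul_sign_del //.
by rewrite (ltn_swap_sign ij); rewrite [X in X *: _](_ : _ = 0) ?scale0r //; ring.
Qed.

(** Summed over [i], these projections multiply the coefficient at [T] by [#|T|]: this is the origin
    of the shift of the Euler operator in L. *)
Lemma wedge_contract i c :
  wedge i (contract i c) = [ffun T : {set 'I_m} => if i \in T then c T else 0].
Proof.
apply/ffunP => T; rewrite !ffunE setD11; case: ifPn => // iT.
by rewrite scalerA koszul_sign_del // ltnn mul1r koszul_signM scale1r finset.setD1K.
Qed.

Lemma chain_map_contract (f : {linear V -> V}) i c :
  chain_map f (contract i c) = contract i (chain_map f c).
Proof. by apply/ffunP => T; rewrite !ffunE; case: ifP; rewrite ?linear0 ?linearZ. Qed.

Lemma chain_map_wedge (f : {linear V -> V}) i c :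
  chain_map f (wedge i c) = wedge i (chain_map f c).
Proof. by apply/ffunP => T; rewrite !ffunE; case: ifP; rewrite ?linear0 ?linearZ. Qed.

(** Exchanging the indices gives S = -S, and 2 is invertible in [K]; the diagonal terms are covered
    as well. *)
Lemma antisym_sum (W : lmodType K) (P : {set 'I_m}) (F : 'I_m -> 'I_m -> W) :
  (forall i j, F i j = - F j i) ->
  \sum_(i in P) \sum_(j in P) F i j = 0.
Proof.
move=> FN; set S := \sum_(i in P) _.
have SN : S = - S.
  rewrite /S {1}exchange_big -sumrN; apply: eq_bigr => i _.
  by rewrite -sumrN; apply: eq_bigr => j _.
have n2 : (2%:R : K) != 0 by rewrite (pcharf0P K).1.
apply/eqP; have : 2%:R *: S == 0 by rewrite scaler_nat mulr2n {2}SN subrr.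
by rewrite scaler_eq0 (negbTE n2).
Qed.

Section Differentials.
Variables (P : {set 'I_m}) (a : 'I_m -> {linear V -> V}).

(** [P] restricts the operators but not the exterior algebra, so that the chain space stays fixed
    when the finiteness argument removes operators one by one. *)
Definition koszul_lower c : chain := \sum_(i in P) chain_map (a i) (contract i c).
Definition koszul_raise c : chain := \sum_(i in P) chain_map (a i) (wedge i c).

Lemma koszul_lower_linear : linear koszul_lower.
Proof.
move=> k c c'; rewrite scaler_sumr -big_split; apply: eq_bigr => i _.
by rewrite !linearP.
Qed.

HB.instance Definition _ :=
  GRing.isLinear.Build K chain chain _ koszul_lower koszul_lower_linear.

Lemma koszul_raise_linear : linear koszul_raise.
Proof.
move=> k c c'; rewrite scaler_sumr -big_split; apply: eq_bigr => i _.
by rewrite !linearP.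
Qed.

HB.instance Definition _ :=
  GRing.isLinear.Build K chain chain _ koszul_raise koszul_raise_linear.

Hypothesis aC : forall i j v, a i (a j v) = a j (a i v).

Lemma chain_mapC i j c :
  chain_map (a i) (chain_map (a j) c) = chain_map (a j) (chain_map (a i) c).
Proof. by apply/ffunP => T; rewrite !ffunE aC. Qed.

Lemma koszul_lowerK c : koszul_lower (koszul_lower c) = 0.
Proof.
rewrite /koszul_lower; under eq_bigr do rewrite !linear_sum.
apply: antisym_sum => i j /=.
by rewrite -!chain_map_contract chain_mapC contract_contract !linearN.
Qed.

Lemma koszul_raiseK c : koszul_raise (koszul_raise c) = 0.
Proof.
rewrite /koszul_raise; under eq_bigr do rewrite !linear_sum.
apply: antisym_sum => i j /=.
by rewrite -!chain_map_wedge chain_mapC wedge_wedge !linearN.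
Qed.

End Differentials.
End KoszulOperators.

(** * The anticommutator of the two Koszul differentials *)

Section KoszulHomotopy.
Variables (K : fieldType) (V : lmodType K) (m : nat).
Hypothesis charK0 : [pchar K] =i pred0.
Local Notation chain := {ffun {set 'I_m} -> V}.
Local Notation lower := (koszul_lower [set: 'I_m]%SET).
Local Notation raise := (koszul_raise [set: 'I_m]%SET).
Implicit Types (S T : {set 'I_m}) (c : chain) (N : set V) (p : int).

(** For each pair (i, j), moving [d i] past [x j] costs [wedge i (contract i c)] when i = j; what
    remains is [x j] after [d i], applied to an anticommutator of [wedge] and [contract], which is
    again a Kronecker delta. *)
Lemma koszul_homotopy (x d : 'I_m -> {linear V -> V}) c T :
  (forall i j v, d i (x j v) = x j (d i v) + (i == j)%:R *: v) ->
  (raise d (lower x c) + lower x (raise d c)) T =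
  \sum_i x i (d i (c T)) + #|T|%:R *: c T.
Proof.
move=> dx.
have -> : raise d (lower x c) = \sum_(i in [set: 'I_m]%SET)
    \sum_(j in [set: 'I_m]%SET) chain_map (d i) (wedge i (chain_map (x j) (contract j c))).
  by apply: eq_bigr => i _; rewrite !linear_sum.
have -> : lower x (raise d c) = \sum_(i in [set: 'I_m]%SET)
    \sum_(j in [set: 'I_m]%SET) chain_map (x j) (contract j (chain_map (d i) (wedge i c))).
  by rewrite exchange_big; apply: eq_bigr => i _; rewrite !linear_sum.
rewrite -big_split /=.
under eq_bigr do rewrite -big_split /=.
have E i j : chain_map (d i) (wedge i (chain_map (x j) (contract j c))) +
    chain_map (x j) (contract j (chain_map (d i) (wedge i c))) =
    chain_map (x j) (chain_map (d i) ((i == j)%:R *: c)) +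
    (i == j)%:R *: wedge i (contract i c).
  rewrite -chain_map_contract -[wedge i (chain_map _ _)]chain_map_wedge.
  have -> : chain_map (d i) (chain_map (x j) (wedge i (contract j c))) =
      chain_map (x j) (chain_map (d i) (wedge i (contract j c))) +
      (i == j)%:R *: wedge i (contract i c).
    apply/ffunP => S; rewrite 3!ffunE dx [RHS]ffunE; congr (_ + _).
      by rewrite !ffunE.
    by have [->|_] := eqVneq i j; rewrite !ffunE ?scale1r ?scale0r.
  rewrite addrAC -!linearD /= addrC [X in chain_map (d i) X]addrC contract_wedge.
  by rewrite eq_sym addrC.
under eq_bigr => i _ do under eq_bigr => j _ do rewrite E.
have E2 i : \sum_(j in [set: 'I_m]%SET)
   (chain_map (x j) (chain_map (d i) ((i == j)%:R *: c)) +
    (i == j)%:R *: wedge i (contract i c)) =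
   chain_map (x i) (chain_map (d i) c) + wedge i (contract i c).
  rewrite (bigD1 i) ?inE //= eqxx !scale1r big1 ?addr0 // => j /andP[_ ji].
  by rewrite eq_sym (negbTE ji) !scale0r !linear0 addr0.
under eq_bigr do rewrite E2.
rewrite big_split ffunE !sum_ffunE; congr (_ + _).
  by apply: eq_big => i; rewrite ?inE // !ffunE.
under eq_bigr do rewrite wedge_contract ffunE.
rewrite -big_mkcondr scaler_nat -sumr_const /=.
by apply: eq_bigl => i; rewrite inE.
Qed.

Definition chains_in N p : set chain :=
  [set c | (forall T, N (c T)) /\ forall T, c T != 0 -> #|T|%:Z = p].

Lemma chains_in_subspace N p : is_subspace N -> is_subspace (chains_in N p).
Proof.
move=> sN; split; first by split=> T; rewrite ffunE ?eqxx //; apply: subspace0.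
move=> k c c' [Nc dc] [Nc' dc']; split=> T; rewrite !ffunE; first exact: sN.2.
have [->|/dc ->//] := eqVneq (c T) 0.
by rewrite scaler0 add0r => /dc'.
Qed.

Lemma chain_map_in N (f : {linear V -> V}) p c : (forall v, N v -> N (f v)) ->
  chains_in N p c -> chains_in N p (chain_map f c).
Proof.
move=> Nf [Nc dc]; split=> T; rewrite ffunE; first exact: Nf.
by move=> fc; apply: dc; apply: contra_neq fc => ->; rewrite linear0.
Qed.

Lemma contract_in N i p c : is_subspace N ->
  chains_in N p c -> chains_in N (p - 1) (contract i c).
Proof.
move=> sN [Nc dc]; split=> T; rewrite ffunE; case: ifPn => iT; rewrite ?eqxx //.
- exact: subspace0.
- exact: subspaceZ.
- rewrite scaler_eq0 negb_or => /andP[_ /dc <-].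
  by rewrite cardsU1 iT; lia.
Qed.

Lemma wedge_in N i p c : is_subspace N ->
  chains_in N p c -> chains_in N (p + 1) (wedge i c).
Proof.
move=> sN [Nc dc]; split=> T; rewrite ffunE; case: ifPn => iT; rewrite ?eqxx //.
- exact: subspaceZ.
- exact: subspace0.
- rewrite scaler_eq0 negb_or => /andP[_ /dc <-].
  by rewrite [in LHS](cardsD1 i T) iT PoszD addrC.
Qed.

Section Stable.
Variables (N : set V) (a : 'I_m -> {linear V -> V}) (P : {set 'I_m}).
Hypotheses (sN : is_subspace N) (Na : forall i v, N v -> N (a i v)).

Lemma koszul_lower_subcomplex : subcomplex (koszul_lower P a) (-1) (chains_in N).
Proof.
split=> [p|p c Nc]; first exact: chains_in_subspace.
apply: subspace_sum => [|i _]; first exact: chains_in_subspace.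
by apply: chain_map_in; [exact: Na|exact: contract_in].
Qed.

Lemma koszul_raise_subcomplex : subcomplex (koszul_raise P a) 1 (chains_in N).
Proof.
split=> [p|p c Nc]; first exact: chains_in_subspace.
apply: subspace_sum => [|i _]; first exact: chains_in_subspace.
by apply: chain_map_in; [exact: Na|exact: wedge_in].
Qed.

End Stable.

Lemma chains_in_sub N N' p : N' `<=` N -> chains_in N' p `<=` chains_in N p.
Proof. by move=> sNN c [Nc dc]; split=> // T; apply: sNN. Qed.

Lemma chains_in_bounded N N' : is_subspace N' ->
  bounded_pair m.+1 (chains_in N) (chains_in N').
Proof.
move=> sN p h c [_ dc]; have c0 T : c T = 0.
  apply/eqP; apply/negPn/negP => /dc pE; case/negP: h; rewrite -pE.
  have Tm : (#|T| <= m)%N by rewrite -[X in (_ <= X)%N]card_ord max_card.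
  lia.
by split=> T; rewrite c0 ?eqxx //; apply: subspace0.
Qed.

(** * The Hodge star exchanges the raising and the lowering differential *)

Section HodgeStar.

(** Up to a factor depending only on [#|T|], this is the sign of the shuffle that lists [T] before
    its complement. It is chosen so that adjoining [i] multiplies it by the sign found in
    [koszul_sign_compl]. *)
Definition star_sign T : K := (-1) ^+ (\sum_(i in T) i).

Definition hodge_star c : chain := [ffun T => star_sign T *: c (~: T)%SET].

Lemma hodge_star_linear : linear hodge_star.
Proof.
by move=> a c c'; apply/ffunP => T; rewrite !ffunE scalerDr !scalerA mulrC.
Qed.

HB.instance Definition _ :=
  GRing.isLinear.Build K chain chain _ hodge_star hodge_star_linear.

Lemma signr_sq n : (-1) ^+ n * (-1) ^+ n = 1 :> K.
Proof. by rewrite -exprD addnn -signr_odd odd_double. Qed.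

(** The indices smaller than [i], of which there are [i], are distributed between [T] and its
    complement. *)
Lemma koszul_sign_compl i T : koszul_sign K i T * koszul_sign K i (~: T)%SET = (-1) ^+ i.
Proof.
rewrite /koszul_sign -exprD; congr (_ ^+ _).
have ci : #|[pred j : 'I_m | (j < i)%N]| = i.
  rewrite -[RHS](size_iota 0) cardE -(size_map val).
  apply/perm_size/uniq_perm; rewrite ?map_inj_uniq ?enum_uniq ?iota_uniq //.
    exact: val_inj.
  move=> k; rewrite mem_iota; apply/mapP/idP => [[j]|ki].
    by rewrite mem_enum => ji ->.
  have km : (k < m)%N by apply: ltn_trans ki (ltn_ord i).
  by exists (Ordinal km); rewrite // mem_enum.
rewrite -[RHS]ci -[RHS](cardID (mem T)); congr (_ + _)%N; apply: eq_card => j.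
  by rewrite !inE andbC.
by rewrite !inE.
Qed.

Lemma star_sign_add i T : i \notin T ->
  star_sign (i |: T)%SET = (-1) ^+ i * star_sign T.
Proof. by move=> iT; rewrite /star_sign big_setU1 // exprD. Qed.

Lemma contract_star i c : contract i (hodge_star c) = hodge_star (wedge i c).
Proof.
apply/ffunP => T; rewrite !ffunE inE; case: ifPn => iT /=; first by rewrite scaler0.
rewrite !scalerA star_sign_add //; congr (_ *: c _); last first.
  by apply/setP => k; rewrite !inE negb_or.
rewrite -(koszul_sign_compl i T) -[RHS]mul1r -(koszul_signM K i T).
ring.
Qed.

Lemma lower_star (a : 'I_m -> {linear V -> V}) c :
  lower a (hodge_star c) = hodge_star (raise a c).
Proof.
rewrite [hodge_star (raise a c)]linear_sum; apply: eq_bigr => i _.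
by rewrite contract_star; apply/ffunP => T; rewrite !ffunE linearZ.
Qed.

Lemma star_star c : hodge_star (hodge_star c) = star_sign [set: 'I_m]%SET *: c.
Proof.
apply/ffunP => T; rewrite !ffunE finset.setCK scalerA; congr (_ *: _).
rewrite /star_sign -exprD; congr (_ ^+ _).
rewrite [RHS](bigID (mem T)) /=; congr (_ + _)%N; apply: eq_bigl => i.
  by rewrite !inE.
by rewrite !inE.
Qed.

Lemma hodge_star_in N p c : is_subspace N ->
  chains_in N p c -> chains_in N (m%:Z - p) (hodge_star c).
Proof.
move=> sN [Nc dc]; split=> T; rewrite ffunE; first exact: subspaceZ.
rewrite scaler_eq0 negb_or => /andP[_ /dc <-].
have := cardsC T; rewrite card_ord; lia.
Qed.

Lemma hodge_star_onto N p c : is_subspace N -> chains_in N p c ->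
  exists2 b, chains_in N (m%:Z - p) b & c = hodge_star b.
Proof.
move=> sN Nc; exists (star_sign [set: 'I_m]%SET *: hodge_star c).
  apply: subspaceZ; first exact: chains_in_subspace.
  exact: hodge_star_in.
by rewrite linearZ /= star_star scalerA signr_sq scale1r.
Qed.

Lemma hodge_star_reflect N p c : is_subspace N ->
  chains_in N (m%:Z - p) (hodge_star c) -> chains_in N p c.
Proof.
move=> sN /(hodge_star_in sN); rewrite subKr star_star.
have -> : c = star_sign [set: 'I_m]%SET *: (star_sign [set: 'I_m]%SET *: c).
  by rewrite scalerA signr_sq scale1r.
rewrite scalerA signr_sq scale1r => Nc.
by apply: subspaceZ => //; apply: chains_in_subspace.
Qed.

Section StarHomology.
Variables (N N' : set V) (a : 'I_m -> {linear V -> V}).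
Hypotheses (sN : is_subspace N) (sN' : is_subspace N').
Hypotheses (Na : forall i v, N v -> N (a i v))
  (Na' : forall i v, N' v -> N' (a i v)).

Let UL := koszul_lower_subcomplex [set: 'I_m]%SET sN Na.
Let WL := koszul_lower_subcomplex [set: 'I_m]%SET sN' Na'.
Let UR := koszul_raise_subcomplex [set: 'I_m]%SET sN Na.
Let WR := koszul_raise_subcomplex [set: 'I_m]%SET sN' Na'.

Lemma star_homology p :
  homology_fin (lower a) (-1) (chains_in N) (chains_in N') (m%:Z - p) ->
  homology_fin (raise a) 1 (chains_in N) (chains_in N') p /\
  homology_dim (raise a) 1 (chains_in N) (chains_in N') p =
  homology_dim (lower a) (-1) (chains_in N) (chains_in N') (m%:Z - p).
Proof.
move=> fl; have [||||||||fr _ E] := @quot_dim_iso _ _ _ hodge_star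
  (rel_cycles (raise a) 1 (chains_in N) (chains_in N') p)
  (rel_boundaries (raise a) 1 (chains_in N) (chains_in N') p)
  (rel_cycles (lower a) (-1) (chains_in N) (chains_in N') (m%:Z - p))
  (rel_boundaries (lower a) (-1) (chains_in N) (chains_in N') (m%:Z - p)).
- exact: rel_cycles_subspace.
- exact: rel_boundaries_subspace.
- exact: rel_cycles_subspace.
- exact: rel_boundaries_subspace.
- move=> c [Nc Nc']; split; first exact: hodge_star_in.
  by rewrite /= lower_star -addrA -opprD; apply: hodge_star_in.
- move=> c [Nc Nc']; split.
    move=> [w [u [Nw Nu cE]]].
    have [w' Nw' wE] := hodge_star_onto sN' Nw.
    have [u' Nu' uE] := hodge_star_onto sN Nu.
    rewrite subKr in Nw'; rewrite opprK in Nu'.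
    have p1 : m%:Z - (m%:Z - p + 1) = p - 1 by lia.
    rewrite p1 in Nu'.
    exists w', u'; split=> //.
    have /(congr1 hodge_star) : hodge_star c = hodge_star (w' + raise a u').
      by rewrite [LHS]cE wE uE /= lower_star -linearD.
    rewrite !star_star => /(congr1 (fun x => star_sign [set: 'I_m]%SET *: x)).
    by rewrite !scalerA signr_sq !scale1r.
  move=> [w [u [Nw Nu ->]]]; exists (hodge_star w), (hodge_star u); split.
  + exact: hodge_star_in.
  + by have := hodge_star_in sN Nu; rewrite opprB addrA opprK addrAC.
  + by rewrite /= lower_star linearD.
- move=> c [Nc Nc']; have [b Nb cE] := hodge_star_onto sN Nc.
  rewrite subKr in Nb; exists b.
    split=> //; apply: hodge_star_reflect => //.
    by rewrite -lower_star -cE opprD addrA.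
  by rewrite cE subrr; apply: subspace0; apply: rel_boundaries_subspace.
- by right.
- by split.
Qed.

Hypothesis fin : forall p,
  homology_fin (lower a) (-1) (chains_in N) (chains_in N') p.

Lemma star_euler :
  alt_sum m.+1 (homology_dim (raise a) 1 (chains_in N) (chains_in N')) =
  (-1) ^+ m * alt_sum m.+1 (homology_dim (lower a) (-1) (chains_in N) (chains_in N')).
Proof.
rewrite /alt_sum (reindex_inj rev_ord_inj) mulr_sumr; apply: eq_bigr => k _ /=.
have km : (k <= m)%N by rewrite -ltnS.
rewrite subSS (star_homology _).2; last exact: fin.
have -> : m%:Z - (m - k)%N%:Z = k by lia.
rewrite mulrA -signr_odd oddB // signr_addb !signr_odd.
by congr (_ * _); rewrite -exprD.
Qed.

End StarHomology.
End HodgeStar.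
End KoszulHomotopy.

(** * Finiteness of Koszul homology *)

Section Growth.
Variables (K : fieldType) (V : lmodType K).
Hypothesis charK0 : [pchar K] =i pred0.
Variable F : nat -> set V.
Hypothesis F_incr : forall k, F k `<=` F k.+1.
Hypothesis F_exhaust : forall v, exists k, F k v.
Implicit Types (N : set V).

(* For a good filtration F of a holonomic module this holds with p the number of
   variables, and it passes to all subquotients. *)
Definition growth_bounded N N' (C p : nat) := forall k r (e : 'I_r -> V),
  (forall i, N (e i) /\ F k (e i)) -> indep_mod N' e -> (r <= C * k.+1 ^ p)%N.

Lemma F_mono k l : (k <= l)%N -> F k `<=` F l.
Proof.
by move=> kl; rewrite -(subnK kl); elim: (l - k)%N => // n IH v /IH/F_incr.
Qed.

Lemma growth_bounded_finType N N' C p k (I : finType) (e : I -> V) :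
  growth_bounded N N' C p -> (forall i, N (e i) /\ F k (e i)) ->
  (forall c : I -> K, N' (\sum_i c i *: e i) -> forall i, c i = 0) ->
  (#|I| <= C * k.+1 ^ p)%N.
Proof.
move=> gN Ne ie; apply: (gN _ _ (e \o enum_val)) => [i|c Nc]; first exact: Ne.
apply/rowP => i; rewrite mxE -(enum_valK i).
apply: (ie (fun x => c 0 (enum_rank x))).
rewrite (reindex _ (onW_bij _ (enum_val_bij I))) /=.
rewrite (_ : \sum_j _ = lin_comb c (e \o enum_val)) //.
by apply: eq_bigr => j _; rewrite enum_valK.
Qed.

(** With exponent 0 the bound no longer depends on [k], and any finite family lies in a common
    [F k]. *)
Lemma growth_bounded0_fin N N' C : is_subspace N -> is_subspace N' ->
  growth_bounded N N' C 0 -> fin_quot N N'.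
Proof.
move=> sN sN' gN; apply: (@indep_bounded_fin _ _ _ _ C) => // r e Ne ie.
have /choice[k Fk] := fun i => F_exhaust (e i).
have -> : C = (C * (\max_i k i).+1 ^ 0)%N by rewrite expn0 muln1.
apply: (gN (\max_i k i)%N _ e) => // i; split=> //.
exact: F_mono (leq_bigmax i) _ (Fk i).
Qed.

(** * Growth of the kernel and the cokernel of one operator *)

Section WeylPair.
Variables (a b : {linear V -> V}).
Hypothesis abE : forall v, a (b v) = b (a v) + v.
Hypothesis aF : forall k v, F k v -> F k.+1 (a v).
Hypothesis bF : forall k v, F k v -> F k.+1 (b v).
Variables N N' : set V.
Hypotheses (sN : is_subspace N) (sN' : is_subspace N') (NN : N' `<=` N).
Hypotheses (aN : forall v, N v -> N (a v)) (bN : forall v, N v -> N (b v)).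
Hypotheses (aN' : forall v, N' v -> N' (a v)) (bN' : forall v, N' v -> N' (b v)).

Definition ker_mod : set V := [set v | N v /\ N' (a v)].
Definition im_mod : set V :=
  [set v | exists w n, [/\ N w, N' n & v = a w + n]].

Lemma ker_mod_subspace : is_subspace ker_mod.
Proof.
split; first by split; rewrite ?linear0; apply: subspace0.
by move=> c u v [Nu Nau] [Nv Nav]; split; rewrite ?linearP; [apply: sN.2|apply: sN'.2].
Qed.

Lemma im_mod_subspace : is_subspace im_mod.
Proof.
split; first by exists 0, 0; rewrite linear0 addr0; split=> //; apply: subspace0.
move=> c _ _ [w [n [Nw Nn ->]]] [w' [n' [Nw' Nn' ->]]].
exists (c *: w + w'), (c *: n + n'); split; [exact: sN.2|exact: sN'.2|].
by rewrite linearP scalerDr addrACA.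
Qed.

Lemma natr_neq0 n : (n.+1%:R : K) != 0.
Proof. by rewrite (pcharf0P K).1. Qed.

Lemma scale_natr_cancel (U : set V) n v :
  is_subspace U -> U (n.+1%:R *: v) -> U v.
Proof.
by move=> sU /(subspaceZ n.+1%:R^-1 sU); rewrite scalerA mulVf ?natr_neq0 // scale1r.
Qed.

(** The commutator of [a] with the l-th power of [b]; at l = 0 the truncated predecessor is
    harmless, its coefficient being zero. *)
Lemma a_iter_b l v : a (iter l b v) = iter l b (a v) + l%:R *: iter l.-1 b v.
Proof.
elim: l => [|l IH] /=; first by rewrite scale0r addr0.
rewrite abE IH linearD linearZ /= -addrA; congr (_ + _).
case: l {IH} => [|l]; first by rewrite scale0r add0r scale1r.
by rewrite /= -[in RHS]natr1 scalerDl scale1r.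
Qed.

Lemma iter_a_b l v : iter l a (b v) = b (iter l a v) + l%:R *: iter l.-1 a v.
Proof.
elim: l => [|l IH] /=; first by rewrite scale0r addr0.
rewrite IH linearD linearZ /= abE -addrA; congr (_ + _).
case: l {IH} => [|l]; first by rewrite scale0r addr0 scale1r.
by rewrite /= -[in RHS]natr1 scalerDl scale1r addrC.
Qed.

Lemma iter_stable (f : V -> V) (U : set V) l v :
  (forall v, U v -> U (f v)) -> U v -> U (iter l f v).
Proof. by move=> fU Uv; elim: l => //= l; apply: fU. Qed.

Lemma iter_F (f : V -> V) k l v :
  (forall k v, F k v -> F k.+1 (f v)) -> F k v -> F (l + k)%N (iter l f v).
Proof. by move=> fF Fv; elim: l => //= l; apply: fF. Qed.

Lemma iter_linear (f : {linear V -> V}) l (c : K) v w :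
  iter l f (c *: v + w) = c *: iter l f v + iter l f w.
Proof. by elim: l => //= l ->; rewrite linearP. Qed.

Lemma iter_linearZ (f : {linear V -> V}) l (c : K) v :
  iter l f (c *: v) = c *: iter l f v.
Proof. by elim: l => //= l ->; rewrite linearZ. Qed.

Lemma iter_linear_sum (f : {linear V -> V}) l (I : Type) (s : seq I) (G : I -> V) :
  iter l f (\sum_(i <- s) G i) = \sum_(i <- s) iter l f (G i).
Proof. by elim: l => //= l ->; rewrite linear_sum. Qed.

(* Applying a lowers the degree in b of a relation between the b^l z_l. *)
Lemma iter_b_indep n (z : nat -> V) : (forall l, ker_mod (z l)) ->
  N' (\sum_(l < n) iter l b (z l)) -> forall l, (l < n)%N -> N' (z l).
Proof.
elim: n z => // n IH z kz Nz.
have zS l : (l < n)%N -> N' (z l.+1).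
  move=> ln; apply: (@scale_natr_cancel _ l) => //.
  apply: (IH (fun l => l.+1%:R *: z l.+1)) ln => [q|].
    by apply: subspaceZ => //; apply: ker_mod_subspace.
  have := aN' Nz; rewrite linear_sum big_ord_recl /= => Na.
  have {}Na := subspace_addKl sN' (kz 0%N).2 Na.
  rewrite (_ : \sum_(l0 < n) _ = \sum_(i < n) a (iter (bump 0 i) b (z (bump 0 i))) -
      \sum_(i < n) iter i.+1 b (a (z i.+1))).
    apply: subspaceB => //; apply: subspace_sum => // i _.
    by apply: iter_stable => //; case: (kz i.+1).
  rewrite -sumrB; apply: eq_bigr => i _.
  by rewrite a_iter_b /= iter_linearZ addrAC subrr add0r.
case=> [_|l]; last by rewrite ltnS; apply: zS.
move: Nz; rewrite big_ord_recl /=; apply: subspace_addKr => //.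
apply: subspace_sum => // i _; apply: (@iter_stable _ _ i.+1) => //.
exact: zS.
Qed.

(** If [N'] contains a^(s+1) v, the commutation rule shows that a^s sends (s+1) v - a (b v) into
    [N']. By induction this vector lies in [im_mod], hence so does (s+1) v, and s+1 is
    invertible. *)
Lemma iter_a_ker s v : N v -> N' (iter s a v) -> im_mod v.
Proof.
elim: s v => [v Nv /= N'v|s IH v Nv Nsv].
  by exists 0, v; rewrite linear0 add0r; split=> //; apply: subspace0.
have sI := im_mod_subspace.
have aI w : N w -> im_mod (a w).
  by move=> Nw; exists w, 0; rewrite addr0; split=> //; apply: subspace0.
apply: (@scale_natr_cancel _ s) => //.
apply: (@subspace_addKr _ _ _ _ (- a (b v))) => //.
  by apply: subspaceN => //; apply: aI; apply: bN.
apply: IH.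
  by apply: subspaceB => //; [apply: subspaceZ|apply: aN; apply: bN].
rewrite iter_linear -scaleN1r iter_linearZ scaleN1r -iterSr iter_a_b.
by rewrite addrC opprD subrK; apply: subspaceN => //; apply: bN'.
Qed.

(** By [iter_a_ker] the inner sum lies in [im_mod]; all its terms but [z 0] do so visibly, hence
    [z 0] vanishes. A factor [a] then comes out of the remaining sum, which is why [s] has to vary
    in the induction. *)
Lemma iter_a_indep (S : set V) n s (z : nat -> V) : (forall v, S v -> N v) ->
  (forall v, S v -> im_mod v -> v = 0) -> (forall l, S (z l)) ->
  N' (iter s a (\sum_(l < n) iter l a (z l))) -> forall l, (l < n)%N -> z l = 0.
Proof.
move=> SN SI; elim: n s z => // n IH s z Sz Nz.
have Nsum n' (z' : nat -> V) : (forall l, S (z' l)) -> N (\sum_(l < n') iter l a (z' l)).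
  move=> Sz'; apply: subspace_sum => // i _; apply: iter_stable => //.
  exact: SN.
have z0 : z 0%N = 0.
  apply: SI => //.
  have := iter_a_ker (Nsum _ _ Sz) Nz; rewrite big_ord_recl /=.
  apply: subspace_addKr; first exact: im_mod_subspace.
  exists (\sum_(i < n) iter i a (z i.+1)), 0; split.
  - by apply: (Nsum _ (fun l => z l.+1)).
  - exact: subspace0.
  - by rewrite addr0 linear_sum.
case=> // l ln; apply: (IH s.+1 (fun l => z l.+1)) => //.
rewrite iterSr linear_sum; move: Nz; rewrite big_ord_recl /= z0 add0r.
by [].
Qed.

(** From (k + k).+1 <= 2 (k+1): the power 2^(p+1) enters the constant and one factor k+1 is divided
    out. *)
Lemma growth_arith C p k r : (r * k.+1 <= C * (k + k).+1 ^ p.+1)%N ->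
  (r <= C * 2 ^ p.+1 * k.+1 ^ p)%N.
Proof.
move=> h; rewrite -(leq_pmul2r (ltn0Sn k)); apply: leq_trans h _.
rewrite -!mulnA leq_mul2l -expnSr -expnMn leq_exp2r //; apply/orP; right; lia.
Qed.

(** From r independent vectors of the kernel in [F k], the powers b^l with l <= k produce r (k+1)
    independent vectors in [F (k + k)]. For the cokernel the powers of [a] play this part. *)
Lemma growth_ker C p : growth_bounded N N' C p.+1 ->
  growth_bounded ker_mod N' (C * 2 ^ p.+1) p.
Proof.
move=> gN k r e Ne ie; apply: growth_arith.
have <- : #|{: 'I_r * 'I_k.+1}| = (r * k.+1)%N by rewrite card_prod !card_ord.
apply: (growth_bounded_finType (e := fun x : 'I_r * 'I_k.+1 => iter x.2 b (e x.1)) gN).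
  move=> [i l] /=; have [[Ni _] Fi] := Ne i; split; first exact: iter_stable.
  apply: F_mono (iter_F l bF Fi); first by rewrite leq_add2r -ltnS.
move=> c.
rewrite (_ : \sum_x _ = \sum_i \sum_l c (i, l) *: iter (l : 'I_k.+1) b (e i)); last first.
  by rewrite pair_bigA; apply: eq_bigr => -[].
rewrite exchange_big /= => Nc [i l].
pose z (l : nat) := lin_comb (\row_i c (i, inord l)) e.
have : N' (z l).
  apply: (@iter_b_indep k.+1) (ltn_ord l) => [q|].
    by apply: lin_comb_in ker_mod_subspace _ => i'; case: (Ne i').
  rewrite (_ : \sum_(l0 < k.+1) _ = \sum_(j < k.+1) \sum_(i0 < r) c (i0, j) *: iter j b (e i0)) //.
  apply: eq_bigr => j _; rewrite iter_linear_sum; apply: eq_bigr => i' _.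
  by rewrite iter_linearZ mxE inord_val.
by move/ie/rowP/(_ i); rewrite !mxE inord_val.
Qed.

Lemma growth_coker C p : growth_bounded N N' C p.+1 ->
  growth_bounded N im_mod (C * 2 ^ p.+1) p.
Proof.
move=> gN k r e Ne ie; apply: growth_arith.
have <- : #|{: 'I_r * 'I_k.+1}| = (r * k.+1)%N by rewrite card_prod !card_ord.
apply: (growth_bounded_finType (e := fun x : 'I_r * 'I_k.+1 => iter x.2 a (e x.1)) gN).
  move=> [i l] /=; have [Ni Fi] := Ne i; split; first exact: iter_stable.
  apply: F_mono (iter_F l aF Fi); first by rewrite leq_add2r -ltnS.
move=> c.
rewrite (_ : \sum_x _ = \sum_i \sum_l c (i, l) *: iter (l : 'I_k.+1) a (e i)); last first.
  by rewrite pair_bigA; apply: eq_bigr => -[].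
rewrite exchange_big /= => Nc [i l].
pose z (l : nat) := lin_comb (\row_i c (i, inord l)) e.
have z0 : z l = 0.
  apply: (@iter_a_indep [set v | exists c, v = lin_comb c e] k.+1 0) (ltn_ord l).
  - by move=> _ [c' ->]; apply: lin_comb_in => // i'; case: (Ne i').
  - by move=> _ [c' ->] /ie ->; rewrite lin_comb0.
  - by move=> q; exists (\row_i c (i, inord q)).
  rewrite /= (_ : \sum_(l0 < k.+1) _ = \sum_(j < k.+1) \sum_(i0 < r) c (i0, j) *: iter j a (e i0)) //.
  apply: eq_bigr => j _; rewrite iter_linear_sum; apply: eq_bigr => i' _.
  by rewrite iter_linearZ mxE inord_val.
have /ie/rowP/(_ i) : im_mod (z l) by rewrite z0; apply: subspace0; apply: im_mod_subspace.
by rewrite !mxE inord_val.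
Qed.

End WeylPair.
End Growth.

(** * Finite Koszul homology by induction on the operators *)

Section KoszulFiniteness.
Variables (K : fieldType) (V : lmodType K) (m : nat).
Hypothesis charK0 : [pchar K] =i pred0.
Local Notation chain := {ffun {set 'I_m} -> V}.
Implicit Types (T P : {set 'I_m}) (c : chain) (N : set V).

Lemma koszul_lowerE P (a : 'I_m -> {linear V -> V}) c T :
  koszul_lower P a c T =
  \sum_(i in P | i \notin T) koszul_sign K i T *: a i (c (i |: T)%SET).
Proof.
rewrite sum_ffunE big_mkcondr; apply: eq_bigr => i _.
by rewrite !ffunE; case: ifP; rewrite /= ?linear0 ?linearZ.
Qed.

(** Chains of all degrees together: the induction runs on the total complex, a constant family, so
    that its index 0 stands for every degree. *)
Definition chains_over N : set chain := [set c | forall T, N (c T)].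

Lemma chains_over_subspace N : is_subspace N -> is_subspace (chains_over N).
Proof.
move=> sN; split=> [T|k c c' Nc Nc' T]; rewrite !ffunE; first exact: subspace0.
exact: sN.2.
Qed.

Lemma chains_over_fin N N' : is_subspace N -> is_subspace N' ->
  fin_quot N N' -> fin_quot (chains_over N) (chains_over N').
Proof.
move=> sN sN' [d /has_quot_dimE[]// e [Ne ie se]].
have sC := chains_over_subspace sN; have sC' := chains_over_subspace sN'.
pose I := ({set 'I_m} * 'I_d)%type.
pose f (x : I) : chain := [ffun T => if T == x.1 then e x.2 else 0].
apply: (spans_finType_fin sC sC' (f := f)) => c Nc.
have /choice[k Hk] := fun T => se (c T) (Nc T).
exists (fun x => k x.1 0 x.2) => T.
suff E : (\sum_x k x.1 0 x.2 *: f x) T = lin_comb (k T) e by rewrite !ffunE E.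
rewrite sum_ffunE.
rewrite -(pair_bigA _ (fun S i => (k S 0 i *: f (S, i)) T)) (bigD1 T) //=.
rewrite [X in _ + X]big1 ?addr0 => [|S ST].
  by apply: eq_bigr => i _; rewrite !ffunE eqxx.
by rewrite big1 // => i _; rewrite !ffunE eq_sym (negbTE ST) scaler0.
Qed.

Variables (F : nat -> set V).
Hypothesis F_incr : forall k, F k `<=` F k.+1.
Hypothesis F_exhaust : forall v, exists k, F k v.
Variables (a b : 'I_m -> {linear V -> V}).
Hypothesis aC : forall i j v, a i (a j v) = a j (a i v).
Hypothesis abE : forall i j v, a i (b j v) = b j (a i v) + (i == j)%:R *: v.
Hypothesis aF : forall i k v, F k v -> F k.+1 (a i v).
Hypothesis bF : forall i k v, F k v -> F k.+1 (b i v).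

(** The kernel and the image of [a j] are in general not preserved by [b j], only by the operators
    of other indices; hence the restriction to [P]. *)
Definition stable_on P N := forall i v, i \in P -> N v -> N (a i v) /\ N (b i v).

Lemma stable_on_sub P P' N : P' \subset P -> stable_on P N -> stable_on P' N.
Proof. by move=> /fintype.subsetP PP sN i v /PP; apply: sN. Qed.

Section Step.
Variables (P : {set 'I_m}) (j : 'I_m) (N N' : set V).
Hypothesis jP : j \in P.
Hypotheses (sN : is_subspace N) (sN' : is_subspace N') (NN : N' `<=` N).
Hypotheses (stN : stable_on P N) (stN' : stable_on P N').

Local Notation P' := (P :\ j)%SET.
Local Notation Q := (im_mod (a j) N N').
Local Notation N1 := (ker_mod (a j) N N').

Let sQ : is_subspace Q. Proof. exact: im_mod_subspace. Qed.
Let sN1 : is_subspace N1. Proof. exact: ker_mod_subspace. Qed.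

Lemma ker_mod_stable : stable_on P' N1.
Proof.
move=> i v; rewrite !inE => /andP[ij iP] [Nv N'v].
split; split; try by [case: (stN iP Nv)|case: (stN iP Nv)].
  by rewrite aC; case: (stN' iP N'v).
by rewrite abE eq_sym (negbTE ij) scale0r addr0; case: (stN' iP N'v).
Qed.

Lemma im_mod_stable : stable_on P' Q.
Proof.
move=> i v; rewrite !inE => /andP[ij iP] [w [n [Nw Nn ->]]].
split.
  exists (a i w), (a i n); split; try by [case: (stN iP Nw)|case: (stN' iP Nn)].
  by rewrite linearD /= aC.
exists (b i w), (b i n); split; try by [case: (stN iP Nw)|case: (stN' iP Nn)].
by rewrite linearD /= abE eq_sym (negbTE ij) scale0r addr0.
Qed.

Local Notation dP := (koszul_lower P a).
Local Notation dP' := (koszul_lower P' a).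

Let dPE_in c T : j \in T -> dP c T = dP' c T.
Proof.
move=> jT; rewrite !koszul_lowerE; apply: eq_bigl => i; rewrite !inE.
by have [->|] := eqVneq i j; rewrite ?jT ?andbF.
Qed.

Let dPE_notin c T : j \notin T ->
  dP c T = koszul_sign K j T *: a j (c (j |: T)%SET) + dP' c T.
Proof.
move=> jT; rewrite !koszul_lowerE (bigD1 j) ?jP //=; congr (_ + _).
by apply: eq_bigl => i; rewrite !inE [LHS]andbC andbA.
Qed.

Let const (U : set chain) : int -> set chain := fun _ => U.

(** The sets containing [j] and those avoiding [j] carry two copies of the complex of the other
    operators, with [a j] leading from the first to the second. [U1] shrinks the second copy to the
    image of [a j]; [U2] shrinks it further to [N'] and the first copy to the kernel. *)
Let U1 : set chain := [set c | chains_over N c /\ forall T, j \notin T -> Q (c T)].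
Let U2 : set chain := [set c | forall T, if j \in T then N1 (c T) else N' (c T)].

Let lower_over (X : set V) c : is_subspace X ->
  (forall i v, i \in P -> X v -> X (a i v)) -> chains_over X c ->
  chains_over X (dP c).
Proof.
move=> sX aX Xc T; rewrite koszul_lowerE; apply: subspace_sum => // i /andP[iP _].
by apply: subspaceZ => //; apply: aX.
Qed.

Let NQ : N' `<=` Q.
Proof. by move=> v N'v; exists 0, v; rewrite linear0 add0r; split=> //; apply: subspace0. Qed.

Let aNQ v : N v -> Q (a j v).
Proof. by move=> Nv; exists v, 0; rewrite addr0; split=> //; apply: subspace0. Qed.

Let subU : subcomplex dP (-1) (const (chains_over N)).
Proof.
split=> [p|p c]; first exact: chains_over_subspace.
by apply: (lower_over sN) => i v iP Nv; case: (stN iP Nv).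
Qed.

Let subW : subcomplex dP (-1) (const (chains_over N')).
Proof.
split=> [p|p c]; first exact: chains_over_subspace.
by apply: (lower_over sN') => i v iP Nv; case: (stN' iP Nv).
Qed.

Let lower_sum (X : set V) c T : is_subspace X ->
  (forall i, i \in P' -> i \notin T -> X (a i (c (i |: T)%SET))) -> X (dP' c T).
Proof.
move=> sX Xc; rewrite koszul_lowerE; apply: subspace_sum => // i /andP[iP iT].
by apply: subspaceZ => //; apply: Xc.
Qed.

Let notin_add i T : i \in P' -> j \notin T -> j \notin (i |: T)%SET.
Proof.
by rewrite !inE => /andP[ij _] jT; rewrite negb_or jT eq_sym ij.
Qed.

Let subU1 : subcomplex dP (-1) (const U1).
Proof.
split=> [p|p c [Nc Qc]].
  split; first by split=> [T|T _]; rewrite ffunE; apply: subspace0.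
  move=> k c c' [Nc Qc] [Nc' Qc']; split=> [T|T jT]; rewrite !ffunE.
    exact: sN.2.
  by apply: sQ.2; [apply: Qc|apply: Qc'].
split; first exact: (subU.2 0).
move=> T jT; rewrite dPE_notin //; apply: subspaceD => //.
  by apply: subspaceZ => //; apply: aNQ.
apply: lower_sum => // i iP iT.
by have [] := im_mod_stable iP (Qc _ (notin_add iP jT)).
Qed.

Let subU2 : subcomplex dP (-1) (const U2).
Proof.
split=> [p|p c U2c].
  split; first by move=> T; rewrite ffunE; case: ifP => _; apply: subspace0.
  move=> k c c' U2c U2c' T; move: (U2c T) (U2c' T); rewrite !ffunE.
  by case: ifP => _; [apply: sN1.2|apply: sN'.2].
move=> T; case: ifPn => jT.
  rewrite dPE_in //; apply: lower_sum => // i iP iT.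
  have := U2c (i |: T)%SET; rewrite inE jT orbT => N1c.
  by have [] := ker_mod_stable iP N1c.
rewrite dPE_notin //; apply: subspaceD => //.
  by apply: subspaceZ => //; have := U2c (j |: T)%SET; rewrite setU11 => -[].
apply: lower_sum => // i iP iT.
have := U2c (i |: T)%SET; rewrite (negbTE (notin_add iP jT)) => N'c.
by have [] := stN' (fintype.subsetP (finset.subD1set P j) i iP) N'c.
Qed.

Let U1U : U1 `<=` chains_over N. Proof. by move=> c []. Qed.

Let U2U1 : U2 `<=` U1.
Proof.
move=> c U2c; split=> [T|T jT]; have := U2c T; first by case: ifP => _ => [[]|/NN].
by rewrite (negbTE jT) => /NQ.
Qed.

Let WU2 : chains_over N' `<=` U2.
Proof.
move=> c N'c T; case: ifP => _ //; split; first exact: NN.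
by have [] := stN' jP (N'c T).
Qed.

(* U/U1 is the Koszul complex of the cokernel of a j, and U2/W that of its
   kernel, both on the remaining operators. *)
Let finUU1 :
  homology_fin dP' (-1) (const (chains_over N)) (const (chains_over Q)) 0 ->
  homology_fin dP (-1) (const (chains_over N)) (const U1) 0.
Proof.
have sub' : subcomplex dP' (-1) (const (chains_over N)).
  split=> [p|p c Nc T]; first exact: chains_over_subspace.
  by apply: lower_sum => // i /(fintype.subsetP (finset.subD1set P j)) iP _; case: (stN iP (Nc (i |: T)%SET)).
have subQ' : subcomplex dP' (-1) (const (chains_over Q)).
  split=> [p|p c Nc T]; first exact: chains_over_subspace.
  by apply: lower_sum => // i iP _; case: (im_mod_stable iP (Nc (i |: T)%SET)).
(* Only the coefficients at sets avoiding [j] matter modulo [U1]. *)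
pose f c : chain := [ffun T : {set 'I_m} => if j \in T then 0 else c T].
have f_lin : linear f.
  move=> k c c'; apply/ffunP => T; rewrite !ffunE; case: ifP => // _.
  by rewrite scaler0 addr0.
pose fL := HB.pack_for {linear chain -> chain} f
  (GRing.isLinear.Build K chain chain _ f f_lin).
apply: (@fin_quot_inj _ _ _ fL).
- exact: rel_cycles_subspace.
- exact: rel_boundaries_subspace.
- exact: rel_cycles_subspace.
- exact: rel_boundaries_subspace.
- move=> c [Nc [Ndc Qdc]]; split=> T.
    by rewrite ffunE; case: ifP => _ //; apply: subspace0.
  have [jT|jT] := boolP (j \in T).
    rewrite koszul_lowerE big1 => [|i _]; first exact: subspace0.
    by rewrite ffunE inE jT orbT linear0 scaler0.
  have -> : dP' (fL c) T = dP' c T.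
    rewrite !koszul_lowerE; apply: eq_bigr => i /andP[iP _].
    by rewrite ffunE (negbTE (notin_add iP jT)).
  have := Qdc T jT; rewrite dPE_notin //; apply: subspace_addKl => //.
  by apply: subspaceZ => //; apply: aNQ.
- move=> c [Nc Qdc] [w [u [Qw Nu cE]]].
  exists (c - dP u), u; split=> //; last by rewrite subrK.
  split=> [T|T jT]; rewrite !ffunE.
    by apply: subspaceB => //; apply: (subU.2 0).
  rewrite dPE_notin // opprD addrCA; apply: subspaceD => //.
    by apply: subspaceN => //; apply: subspaceZ => //; apply: aNQ.
  move/ffunP/(_ T): cE; rewrite !ffunE (negbTE jT) => ->.
  by rewrite addrK.
Qed.

Let finU2W :
  homology_fin dP' (-1) (const (chains_over N1)) (const (chains_over N')) 0 ->
  homology_fin dP (-1) (const U2) (const (chains_over N')) 0.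
Proof.
have sub1 : subcomplex dP' (-1) (const (chains_over N1)).
  split=> [p|p c Nc T]; first exact: chains_over_subspace.
  by apply: lower_sum => // i iP _; case: (ker_mod_stable iP (Nc (i |: T)%SET)).
have sub' : subcomplex dP' (-1) (const (chains_over N')).
  split=> [p|p c Nc T]; first exact: chains_over_subspace.
  by apply: lower_sum => // i /(fintype.subsetP (finset.subD1set P j)) iP _; case: (stN' iP (Nc (i |: T)%SET)).
(* Only the coefficients at sets containing [j] matter: at the others, [U2] already takes values in
   [N']. *)
pose f c : chain := [ffun T : {set 'I_m} => if j \in T then c T else 0].
have f_lin : linear f.
  move=> k c c'; apply/ffunP => T; rewrite !ffunE; case: ifP => // _.
  by rewrite scaler0 addr0.
pose fL := HB.pack_for {linear chain -> chain} f
  (GRing.isLinear.Build K chain chain _ f f_lin).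
have fdP' c T : j \in T -> dP' (fL c) T = dP' c T.
  move=> jT; rewrite !koszul_lowerE; apply: eq_bigr => i _.
  by rewrite ffunE inE jT orbT.
have fdP'0 c T : j \notin T -> dP' (fL c) T = 0.
  move=> jT; rewrite koszul_lowerE big1 // => i /andP[iP _].
  by rewrite ffunE (negbTE (notin_add iP jT)) linear0 scaler0.
apply: (@fin_quot_inj _ _ _ fL).
- exact: rel_cycles_subspace.
- exact: rel_boundaries_subspace.
- exact: rel_cycles_subspace.
- exact: rel_boundaries_subspace.
- move=> c [U2c N'dc]; split=> T.
    by have := U2c T; rewrite ffunE; case: ifP => _ // _; apply: subspace0.
  have [jT|jT] := boolP (j \in T); last by rewrite fdP'0 //; apply: subspace0.
  by rewrite fdP' // -dPE_in.
- move=> c [U2c N'dc] [w [u [N'w N1u cE]]].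
  have U2u : U2 (fL u).
    move=> T; rewrite ffunE; have [jT|jT] := boolP (j \in T); first exact: N1u.
    exact: subspace0.
  exists (c - dP (fL u)), (fL u); split=> //; last by rewrite subrK.
  move=> T; rewrite !ffunE; have [jT|jT] := boolP (j \in T).
    rewrite dPE_in // fdP' //; move/ffunP/(_ T): cE; rewrite !ffunE jT => ->.
    by rewrite addrK.
  apply: subspaceB => //; first by have := U2c T; rewrite (negbTE jT).
  rewrite dPE_notin // fdP'0 // addr0; apply: subspaceZ => //.
  by have := U2u (j |: T)%SET; rewrite setU11 => -[].
Qed.

(* U1/U2 is the cone of the isomorphism induced by a j from N/N1 onto Q/N'. *)
Let finU1U2 : homology_fin dP (-1) (const U1) (const U2) 0.
Proof.
exists 0%N; apply: has_quot_dim0; first exact: rel_boundaries_subspace.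
move=> c [[Nc Qc] U2dc].
have [w Hw] : exists w : {set 'I_m} -> V, forall T, j \notin T ->
    N (w T) /\ N' (c T - a j (w T)).
  suff /choice[w Hw] : forall T, exists w, j \notin T -> N w /\ N' (c T - a j w).
    by exists w.
  move=> T; have [jT|jT] := boolP (j \in T); first by exists 0.
  have [w [n [Nw N'n cE]]] := Qc T jT.
  by exists w => _; split=> //; rewrite cE addrAC subrr add0r.
(* The preimages [w] under [a j] are moved to the sets containing [j], with the sign that makes the
   boundary of [y] agree with [c] modulo [N'] at the sets avoiding [j]. *)
pose y : chain := [ffun T : {set 'I_m} =>
  if j \in T then koszul_sign K j T *: w (T :\ j)%SET else 0].
have U1y : U1 y.
  split=> [T|T jT]; rewrite ffunE; last by rewrite (negbTE jT); apply: subspace0.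
  case: ifP => _; last exact: subspace0.
  by apply: subspaceZ => //; have [] := Hw (T :\ j)%SET; rewrite ?setD11.
have dy T : j \notin T -> dP y T = a j (w T).
  move=> jT; rewrite dPE_notin // koszul_lowerE [X in _ + X]big1 ?addr0.
    rewrite ffunE setU11 finset.setU1K // linearZ scalerA.
    by rewrite koszul_sign_add // ltnn mul1r koszul_signM scale1r.
  move=> i /andP[iP _]; rewrite ffunE (negbTE (notin_add iP jT)).
  by rewrite linear0 scaler0.
have dr T : dP (c - dP y) T = dP c T.
  by rewrite linearB /= koszul_lowerK ?subr0.
have rT T : j \notin T -> N' ((c - dP y) T).
  by move=> jT; rewrite !ffunE dy //; case: (Hw T jT).
exists (c - dP y), y; split=> //; last by rewrite subrK.
move=> T; case: ifPn => jT; last exact: rT.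
split; first by rewrite !ffunE; apply: subspaceB => //; apply: (subU.2 0); case: U1y.
(* At [T :\ j] the boundary of [c - dP y], which is that of [c], lies in [N']. The terms of the
   other operators lie in [N'] by [rT], so the [a j] term does too, and this is membership in the
   kernel. *)
have jT' : j \notin (T :\ j)%SET by rewrite setD11.
have := U2dc (T :\ j)%SET; rewrite (negbTE jT') -dr dPE_notin // finset.setD1K //.
move=> N'd; apply: (subspace_addKr sN' _ (v := 0)); first exact: subspace0.
rewrite addr0 -[a j _]scale1r -(koszul_signM K j (T :\ j)%SET) -scalerA.
apply: subspaceZ => //; apply: subspace_addKr N'd => //.
apply: lower_sum => // i iP _.
have iP' := fintype.subsetP (finset.subD1set P j) i iP.
by have [] := stN' iP' (rT _ (notin_add iP jT')).
Qed.

Lemma koszul_fin_step :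
  homology_fin dP' (-1) (const (chains_over N)) (const (chains_over Q)) 0 ->
  homology_fin dP' (-1) (const (chains_over N1)) (const (chains_over N')) 0 ->
  homology_fin dP (-1) (const (chains_over N)) (const (chains_over N')) 0.
Proof.
move=> fQ f1; have dK := koszul_lowerK charK0 P aC.
have fW : homology_fin dP (-1) (const U1) (const (chains_over N')) 0.
  by apply: (homology_fin_ext dK subU1 subU2 subW) => //; apply: finU2W.
apply: (homology_fin_ext dK subU subU1 subW) => //; last exact: finUU1.
by move=> q c /WU2/U2U1.
Qed.

End Step.

(** The growth exponent equals the number of operators left, so both reach 0 together; then the
    differential is zero and [N/N'] is finite-dimensional. *)
Lemma koszul_over_fin P N N' C : is_subspace N -> is_subspace N' -> N' `<=` N ->
  stable_on P N -> stable_on P N' -> growth_bounded F N N' C #|P| ->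
  homology_fin (koszul_lower P a) (-1)
    (fun _ => chains_over N) (fun _ => chains_over N') 0.
Proof.
have [n] := ubnP #|P|; elim: n => // n IH in P N N' C * => Pn sN sN' NN stN stN' gN.
have sC := chains_over_subspace sN; have sC' := chains_over_subspace sN'.
have [P0|[j jP]] := set_0Vmem P.
  have fN : fin_quot N N' by apply: (growth_bounded0_fin F_incr F_exhaust (C := C)) => //; rewrite P0 cards0 in gN.
  have d0 c : koszul_lower P a c = 0.
    by apply/ffunP => T; rewrite koszul_lowerE big1 ?ffunE // => i; rewrite P0 inE.
  have subX X : is_subspace X -> subcomplex (koszul_lower P a) (-1) (fun _ => chains_over X).
    move=> sX; split=> [p|p c _]; first exact: chains_over_subspace.
    by rewrite /= d0; apply: subspace0; apply: chains_over_subspace.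
  apply: fin_quot_mono (chains_over_fin sN sN' fN) => //.
  - by apply: rel_cycles_subspace; apply: subX.
  - by apply: rel_boundaries_subspace; apply: subX.
  - by move=> c [].
  - by move=> c _ N'c; apply: rel_boundariesW => //; apply: subX.
have [cardP abj] : (#|P| = #|P :\ j|%SET.+1)%N /\ forall v, a j (b j v) = b j (a j v) + v.
  by rewrite (cardsD1 j) jP; split=> // v; rewrite abE eqxx scale1r.
rewrite cardP in gN Pn.
have aN v : N v -> N (a j v) by case/(stN j v jP).
have bN v : N v -> N (b j v) by case/(stN j v jP).
have aN' v : N' v -> N' (a j v) by case/(stN' j v jP).
have bN' v : N' v -> N' (b j v) by case/(stN' j v jP).
have PP := finset.subD1set P j.
apply: (koszul_fin_step jP) => //.
  apply: (IH _ _ _ (C * 2 ^ #|P :\ j|%SET.+1)%N) => //.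
  - exact: im_mod_subspace.
  - by move=> v [w [u [Nw N'u ->]]]; apply: subspaceD => //; [apply: aN|apply: NN].
  - exact: stable_on_sub PP stN.
  - exact: im_mod_stable.
  - by apply: (growth_coker charK0 F_incr abj (aF j)).
apply: (IH _ _ _ (C * 2 ^ #|P :\ j|%SET.+1)%N) => //.
- exact: ker_mod_subspace.
- by move=> v N'v; split; [apply: NN|apply: aN'].
- exact: ker_mod_stable.
- exact: stable_on_sub PP stN'.
- by apply: (growth_ker charK0 F_incr abj (bF j)).
Qed.

Lemma koszul_fin N N' C p : is_subspace N -> is_subspace N' -> N' `<=` N ->
  (forall i v, N v -> N (a i v) /\ N (b i v)) ->
  (forall i v, N' v -> N' (a i v) /\ N' (b i v)) -> growth_bounded F N N' C m ->
  homology_fin (koszul_lower [set: 'I_m]%SET a) (-1) (chains_in N) (chains_in N') p.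
Proof.
move=> sN sN' NN stN stN' gN.
have subX X : is_subspace X -> (forall i v, X v -> X (a i v) /\ X (b i v)) ->
  subcomplex (koszul_lower [set: 'I_m]%SET a) (-1) (fun _ => chains_over X).
  move=> sX aX; split=> [q|q c Xc T]; first exact: chains_over_subspace.
  rewrite koszul_lowerE; apply: subspace_sum => // i _.
  by apply: subspaceZ => //; case: (aX i _ (Xc (i |: T)%SET)).
have subY X : is_subspace X -> (forall i v, X v -> X (a i v) /\ X (b i v)) ->
  subcomplex (koszul_lower [set: 'I_m]%SET a) (-1) (chains_in X).
  by move=> sX aX; apply: (koszul_lower_subcomplex _ sX) => i v /(aX i)[].
have := @koszul_over_fin [set: 'I_m]%SET N N' C sN sN' NN.
move=> /(_ (fun i v _ => stN i v) (fun i v _ => stN' i v)).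
rewrite cardsT card_ord => /(_ gN).
apply: (@fin_quot_inj _ _ _ idfun).
- by apply: rel_cycles_subspace; apply: subY.
- by apply: rel_boundaries_subspace; apply: subY.
- by apply: rel_cycles_subspace; apply: subX.
- by apply: rel_boundaries_subspace; apply: subX.
- by move=> c [[Nc _] [N'c _]].
move=> c [[Nc dc] [N'dc _]] [w [u [N'w Nu cE]]].
(* A bounding chain in the total complex may have components of every degree; keeping those of
   degree [p + 1] suffices to bound a chain of degree [p]. *)
pose trunc (q : int) (x : chain) : chain :=
  [ffun T : {set 'I_m} => if #|T|%:Z == q then x T else 0].
have truncP X q x : is_subspace X -> chains_over X x -> chains_in X q (trunc q x).
  move=> sX Xx; split=> T; rewrite ffunE; case: ifP => [/eqP Tq|_] //.
    exact: subspace0.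
  by rewrite eqxx.
exists (trunc p w), (trunc (p + 1) u); rewrite opprK; split; try exact: truncP.
apply/ffunP => T; rewrite [RHS]ffunE koszul_lowerE.
have cT : c T = w T + koszul_lower [set: 'I_m]%SET a u T by have /= -> := cE; rewrite ffunE.
rewrite ffunE; case: ifPn => [/eqP Tp|Tp].
  rewrite cT koszul_lowerE; congr (_ + _); apply: eq_bigr => i /andP[_ iT].
  by rewrite ffunE cardsU1 iT -Tp addrC eqxx.
rewrite big1 ?addr0 => [|i /andP[_ iT]].
  by apply/eqP; apply: contraNT Tp => /dc ->.
rewrite ffunE cardsU1 iT PoszD [1 + _]addrC (inj_eq (addIr _)) (negbTE Tp).
by rewrite linear0 scaler0.
Qed.

End KoszulFiniteness.

(** * The filtration by generalized eigenvectors of the Euler operator *)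

Section Kspan.
Variables (K : fieldType) (V : lmodType K).
Implicit Types (S U : set V).

Lemma Kspan_incl S : S `<=` Kspan S.
Proof.
by move=> v Sv; exists 1%N, (fun _ => 1), (fun _ => v); rewrite big_ord1 scale1r.
Qed.

Lemma Kspan_min S U : is_subspace U -> S `<=` U -> Kspan S `<=` U.
Proof.
move=> sU SU _ [r [c [s [Ss ->]]]]; apply: subspace_sum => // i _.
by apply: subspaceZ => //; apply: SU.
Qed.

Lemma Kspan_subspace S : is_subspace (Kspan S).
Proof.
split; first by exists 0%N, (fun _ => 0), (fun _ => 0); rewrite big_ord0; split=> // -[].
move=> k _ _ [r [c [s [Ss ->]]]] [r' [c' [s' [Ss' ->]]]].
pose c2 (i : 'I_(r + r')) := match split i with inl j => k * c j | inr j => c' j end.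
pose s2 (i : 'I_(r + r')) := match split i with inl j => s j | inr j => s' j end.
exists (r + r')%N, c2, s2; split=> [i|]; first by rewrite /s2; case: split.
rewrite big_split_ord scaler_sumr; congr (_ + _); apply: eq_bigr => i _.
  by rewrite /c2 /s2 (unsplitK (inl i)) scalerA.
by rewrite /c2 /s2 (unsplitK (inr i)).
Qed.

End Kspan.

Section WeylModule.
Variables (K : fieldType) (V : lmodType K) (m : nat).
Hypothesis charK0 : [pchar K] =i pred0.
Variable F : nat -> set V.
Hypothesis F_incr : forall k, F k `<=` F k.+1.
Hypothesis F_exhaust : forall v, exists k, F k v.
Variables (x d : 'I_m -> {linear V -> V}).
Hypothesis xC : forall i j v, x i (x j v) = x j (x i v).
Hypothesis dC : forall i j v, d i (d j v) = d j (d i v).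
Hypothesis dx : forall i j v, d i (x j v) = x j (d i v) + (i == j)%:R *: v.
Hypothesis xF : forall i k v, F k v -> F k.+1 (x i v).
Hypothesis dF : forall i k v, F k v -> F k.+1 (d i v).
Hypothesis F_subspace : forall k, is_subspace (F k).
Variable C : nat.
Hypothesis F_growth : growth_bounded F setT [set (0 : V)] C m.

Local Notation lower := (koszul_lower [set: 'I_m]%SET).
Local Notation raise := (koszul_raise [set: 'I_m]%SET).

Definition weyl_stable (N : set V) :=
  is_subspace N /\ forall i v, N v -> N (x i v) /\ N (d i v).

Definition shifted_euler (c : K) (v : V) : V := \sum_i x i (d i v) + c *: v.

Lemma shifted_euler_linear c : linear (shifted_euler c).
Proof.
move=> k u v; rewrite /shifted_euler.
under eq_bigr do rewrite !linearP.
by rewrite big_split /= -scaler_sumr !scalerDr addrACA !scalerA [c * k]mulrC.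
Qed.

HB.instance Definition _ c :=
  GRing.isLinear.Build K V V _ (shifted_euler c) (shifted_euler_linear c).

(** Independence modulo [N'] implies independence modulo 0, so the bound for the whole module serves
    all subquotients. *)
Lemma weyl_growth N N' : weyl_stable N' -> growth_bounded F N N' C m.
Proof.
move=> [sN' _] k r e Ne ie; apply: (F_growth (k := k) (e := e)) => [i|c c0].
  by split=> //; case: (Ne i).
by apply: ie; rewrite c0; apply: subspace0.
Qed.

Section Pair.
Variables N N' : set V.
Hypotheses (wN : weyl_stable N) (wN' : weyl_stable N') (NN : N' `<=` N).

Lemma lower_d_fin p :
  homology_fin (lower d) (-1) (chains_in N) (chains_in N') p.
Proof.
have [[sN stN] [sN' stN']] := (wN, wN').
apply: (koszul_fin charK0 F_incr F_exhaust dC dx dF xF _ sN sN') => //.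
- by move=> i v /(stN i)[].
- by move=> i v /(stN' i)[].
- exact: weyl_growth.
Qed.

Lemma lower_x_fin p :
  homology_fin (lower x) (-1) (chains_in N) (chains_in N') p.
Proof.
have [[sN stN] [sN' stN']] := (wN, wN').
(* With the roles exchanged, the partner of [x i] in a Weyl pair is minus [d i]. *)
pose b i : {linear V -> V} := \- d i.
have xb i j v : x i (b j v) = b j (x i v) + (i == j)%:R *: v.
  by rewrite /b /= linearN dx opprD eq_sym subrK.
have bF i k v : F k v -> F k.+1 (b i v).
  by move=> Fv; apply: subspaceN => //; apply: dF.
apply: (koszul_fin charK0 F_incr F_exhaust xC xb xF bF _ sN sN') => //.
- by move=> i v /(stN i)[Nx Nd]; split=> //; apply: subspaceN.
- by move=> i v /(stN' i)[Nx Nd]; split=> //; apply: subspaceN.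
- exact: weyl_growth.
Qed.

Hypothesis N_decomp : forall c v, N v -> exists v0 w,
  [/\ N v0, N' (shifted_euler c v0), N w & v = v0 + shifted_euler c w].
Hypothesis N_reduced : forall c v, N v ->
  N' (shifted_euler c (shifted_euler c v)) -> N' (shifted_euler c v).

Lemma pair_euler :
  alt_sum m.+1 (homology_dim (lower x) (-1) (chains_in N) (chains_in N')) =
  (-1) ^+ m *
  alt_sum m.+1 (homology_dim (lower d) (-1) (chains_in N) (chains_in N')).
Proof.
have [[sN stN] [sN' stN']] := (wN, wN').
have Nx i v : N v -> N (x i v) by case/(stN i).
have Nd i v : N v -> N (d i v) by case/(stN i).
have Nx' i v : N' v -> N' (x i v) by case/(stN' i).
have Nd' i v : N' v -> N' (d i v) by case/(stN' i).
rewrite -(star_euler sN sN' Nd Nd' lower_d_fin).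
pose L c := raise d (lower x c) + lower x (raise d c).
have LE c T : L c T = shifted_euler #|T|%:R (c T) by apply: koszul_homotopy.
apply: (@homotopy_euler _ _ _ (raise d) (lower x) L).
- exact: koszul_raiseK.
- exact: koszul_lowerK.
- by [].
- exact: koszul_raise_subcomplex.
- exact: koszul_raise_subcomplex.
- exact: koszul_lower_subcomplex.
- exact: koszul_lower_subcomplex.
- by move=> q; apply: chains_in_sub.
- exact: chains_in_bounded.
- move=> p u [Nu du].
  (* The last clause makes the chosen decomposition of a zero coefficient trivial, so that the
     assembled chains keep the degree of [u]. *)
  have /choice[f Hf] : forall T : {set 'I_m}, exists f : V * V,
      [/\ N f.1, N' (shifted_euler #|T|%:R f.1), N f.2,
      u T = f.1 + shifted_euler #|T|%:R f.2 & u T = 0 -> f = (0, 0)].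
    move=> T; have [u0|u0] := eqVneq (u T) 0.
      exists (0, 0); split=> //=; rewrite ?linear0; try exact: subspace0.
      by rewrite addr0.
    have [v0 [w [Nv0 Nv1 Nw uE]]] := N_decomp #|T|%:R (Nu T).
    by exists (v0, w); split=> // u0'; rewrite u0' eqxx in u0.
  exists [ffun T => (f T).1], [ffun T => (f T).2]; split.
  + split=> T; rewrite ffunE; first by case: (Hf T).
    by move=> f0; apply: du; apply: contra_neq f0; case: (Hf T) => _ _ _ _ h /h ->.
  + split=> T; rewrite LE ffunE; first by case: (Hf T).
    move=> f0; apply: du; apply: contra_neq f0; case: (Hf T) => _ _ _ _ h /h ->.
    by rewrite linear0.
  + split=> T; rewrite ffunE; first by case: (Hf T).
    by move=> f0; apply: du; apply: contra_neq f0; case: (Hf T) => _ _ _ _ h /h ->.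
  + by apply/ffunP => T; rewrite [RHS]ffunE LE !ffunE; case: (Hf T).
- move=> p u [Nu du] [NLL _]; split=> T; rewrite LE.
    by apply: N_reduced => //; have := NLL T; rewrite !LE.
  by move=> Lu; apply: du; apply: contra_neq Lu => ->; rewrite linear0.
- by move=> p; case: (star_homology sN sN' Nd Nd' (lower_d_fin (m%:Z - p))).
- exact: lower_x_fin.
Qed.

End Pair.

Lemma shifted_eulerC c k v :
  shifted_euler c (shifted_euler k v) = shifted_euler k (shifted_euler c v).
Proof.
have E a w : shifted_euler a w = shifted_euler 0 w + a *: w.
  by rewrite /shifted_euler scale0r addr0.
rewrite (E c (shifted_euler k v)) (E k (shifted_euler c v)) (E c v) (E k v).
have eP : linear (shifted_euler 0) := shifted_euler_linear 0.
move: (shifted_euler 0) eP => e eP; rewrite ![e v + _]addrC !eP !scalerDr.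
rewrite !scalerA [k * c]mulrC ![(c * k) *: v + _]addrC addrACA [RHS]addrACA.
by rewrite [k *: e v + c *: _]addrC.
Qed.

Lemma shifted_eulerB c k v :
  shifted_euler c v = shifted_euler k v + (c - k) *: v.
Proof. by rewrite /shifted_euler scalerBl -addrA [k *: v + _]addrC subrK. Qed.

Lemma shifted_euler_x c i v :
  shifted_euler c (x i v) = x i (shifted_euler (c + 1) v).
Proof.
rewrite /shifted_euler linearD linearZ linear_sum /= scalerDl scale1r addrA.
rewrite addrAC; congr (_ + _); under eq_bigr do rewrite dx linearD /= linearZ /= xC.
rewrite big_split /=; congr (_ + _); rewrite (bigD1 i) //= eqxx scale1r big1 ?addr0 //.
by move=> j /negbTE ->; rewrite scale0r.
Qed.

Lemma shifted_euler_d c i v :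
  shifted_euler c (d i v) = d i (shifted_euler (c - 1) v).
Proof.
rewrite /shifted_euler linearD linearZ linear_sum /= scalerBl scale1r.
under [X in _ = X + _]eq_bigr do rewrite dx dC.
rewrite big_split /= -addrA; congr (_ + _).
rewrite (bigD1 i) //= eqxx scale1r big1 ?addr0; last first.
  by move=> j /negbTE ji; rewrite eq_sym ji scale0r.
by rewrite addrC subrK.
Qed.

(** The scalars range over all of [K], so the steps depend on the module structure alone; the
    grading is used only to show that they exhaust the module. An eigenvector for [c] has Euler
    eigenvalue [- c]. *)
Definition eigen_filtration (a : nat) : set V :=
  Kspan [set v | exists c, iter a (shifted_euler c) v = 0].

Lemma eigen_filtration0 : eigen_filtration 0 = [set 0].
Proof.
apply/seteqP; split=> [|_ ->]; last exact: subspace0 (Kspan_subspace _).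
by apply: Kspan_min; [apply: subspace_set0|move=> v [c]].
Qed.

Lemma eigen_filtration_incr a : eigen_filtration a `<=` eigen_filtration a.+1.
Proof.
apply: Kspan_min; first exact: Kspan_subspace.
by move=> v [c cv]; apply: Kspan_incl; exists c; rewrite /= cv linear0.
Qed.

Lemma Kspan_stable (S : set V) (f : {linear V -> V}) :
  (forall v, S v -> S (f v)) -> forall v, Kspan S v -> Kspan S (f v).
Proof.
move=> Sf; have sS := Kspan_subspace S.
apply: (@Kspan_min _ _ S [set v | Kspan S (f v)]).
  split=> [|c u v /= Su Sv]; first by rewrite /= linear0; apply: subspace0.
  by rewrite linearP; apply: sS.2.
by move=> v /Sf Sv; apply: Kspan_incl.
Qed.

Lemma eigen_filtration_stable a : weyl_stable (eigen_filtration a).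
Proof.
split=> [|i v Nv]; first exact: Kspan_subspace.
split; apply: Kspan_stable Nv => {}v [c cv].
  (* [x i] raises the Euler eigenvalue [- c] by one; below, [d i] lowers it. *)
  exists (c - 1).
  suff -> w : iter a (shifted_euler (c - 1)) (x i w) = x i (iter a (shifted_euler c) w).
    by rewrite cv linear0.
  by elim: a {cv} => //= a ->; rewrite shifted_euler_x subrK.
exists (c + 1).
suff -> w : iter a (shifted_euler (c + 1)) (d i w) = d i (iter a (shifted_euler c) w).
  by rewrite cv linear0.
by elim: a {cv} => //= a ->; rewrite shifted_euler_d addrK.
Qed.

Lemma eigen_filtration_euler a c v :
  eigen_filtration a v -> eigen_filtration a (shifted_euler c v).
Proof.
have [sN stN] := eigen_filtration_stable a.
move=> Nv; apply: subspaceD => //; last exact: subspaceZ.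
by apply: subspace_sum => // i _; case: (stN i _ (stN i _ Nv).2).
Qed.

(** Modulo step [a], step [a.+1] is spanned by eigenvectors of the Euler operator: [shifted_euler c]
    kills those for [c] and is invertible on the others. *)
Lemma eigen_filtration_decomp a c v : eigen_filtration a.+1 v -> exists v0 w,
  [/\ eigen_filtration a.+1 v0, eigen_filtration a (shifted_euler c v0),
      eigen_filtration a.+1 w & v = v0 + shifted_euler c w].
Proof.
have s1 := (eigen_filtration_stable a.+1).1; have s0 := (eigen_filtration_stable a).1.
move: v; apply: (@Kspan_min _ _ _ [set v | exists v0 w,
  [/\ eigen_filtration a.+1 v0, eigen_filtration a (shifted_euler c v0),
      eigen_filtration a.+1 w & v = v0 + shifted_euler c w]]).
  split.
    by exists 0, 0; rewrite linear0 addr0; split=> //; apply: subspace0.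
  move=> k _ _ [v0 [w [h1 h2 h3 ->]]] [v0' [w' [h1' h2' h3' ->]]].
  exists (k *: v0 + v0'), (k *: w + w'); split; rewrite ?linearP.
  - exact: s1.2.
  - exact: s0.2.
  - exact: s1.2.
  - by rewrite scalerDr addrACA.
move=> v [k kv].
have N1v : eigen_filtration a.+1 v by apply: Kspan_incl; exists k.
have N0v : eigen_filtration a (shifted_euler k v).
  by apply: Kspan_incl; exists k; rewrite -iterSr.
have [ck|ck] := eqVneq c k.
  exists v, 0; rewrite linear0 addr0 ck; split=> //; exact: subspace0.
have ck0 : c - k != 0 by rewrite subr_eq0.
(* The identity behind the witnesses is that [shifted_euler c] minus [shifted_euler k] is the scalar
   [c - k], which is invertible here. *)
exists (- (c - k)^-1 *: shifted_euler k v), ((c - k)^-1 *: v); split.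
- by apply: subspaceZ => //; apply: eigen_filtration_incr.
- by rewrite linearZ /=; apply: subspaceZ => //; apply: eigen_filtration_euler.
- exact: subspaceZ.
- rewrite linearZ /= (shifted_eulerB c k) [(c - k)^-1 *: (_ + _)]scalerDr.
  by rewrite [(c - k)^-1 *: (_ *: v)]scalerA mulVf // scale1r scaleNr addrA addNr add0r.
Qed.

Let poly_euler (s : seq K) (v : V) : V := foldr shifted_euler v s.

Let poly_eulerP s k u v :
  poly_euler s (k *: u + v) = k *: poly_euler s u + poly_euler s v.
Proof. by elim: s => //= c s ->; rewrite linearP. Qed.

Let poly_euler_filtration a s v :
  eigen_filtration a v -> eigen_filtration a (poly_euler s v).
Proof. by move=> Nv; elim: s => //= c s; apply: eigen_filtration_euler. Qed.

Let poly_eulerC s c v :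
  poly_euler s (shifted_euler c v) = shifted_euler c (poly_euler s v).
Proof. by elim: s => //= k s ->; rewrite shifted_eulerC. Qed.

Let poly_euler_cat s s' v :
  poly_euler s (poly_euler s' v) = poly_euler s' (poly_euler s v).
Proof. by elim: s => //= k s ->; rewrite poly_eulerC. Qed.

(* Modulo the a-th step, v is a sum of eigenvectors, so that a product of factors
   prime to the shift by c annihilates shifted_euler c v. *)
Let eigen_annihilator a c v : eigen_filtration a.+1 v ->
  exists2 s, c \notin s & eigen_filtration a (poly_euler s (shifted_euler c v)).
Proof.
have s0 := (eigen_filtration_stable a).1.
move: v; apply: (@Kspan_min _ _ _ [set v | exists2 s, c \notin s &
  eigen_filtration a (poly_euler s (shifted_euler c v))]).
  split; first by exists [::] => //=; rewrite linear0; apply: subspace0.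
  move=> k u v [s cs Nu] [s' cs' Nv]; exists (s ++ s').
    by rewrite mem_cat negb_or cs.
  rewrite /poly_euler foldr_cat -/(poly_euler s _) -/(poly_euler s' _).
  rewrite linearP /= !poly_eulerP; apply: s0.2; last exact: poly_euler_filtration.
  by rewrite poly_euler_cat; apply: poly_euler_filtration.
move=> v [k kv].
have N0v : eigen_filtration a (shifted_euler k v).
  by apply: Kspan_incl; exists k; rewrite -iterSr.
have [ck|ck] := eqVneq c k; first by exists [::] => //=; rewrite ck.
exists [:: k]; first by rewrite inE.
by rewrite /= shifted_eulerC; apply: eigen_filtration_euler.
Qed.

(** The vector [shifted_euler c v] is killed modulo step [a] both by [shifted_euler c] and by a
    product of factors with other shifts [k]. On it each such factor acts as the nonzero scalar
    [k - c], so the factors are dropped one at a time. *)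
Lemma eigen_filtration_reduced a c v : eigen_filtration a.+1 v ->
  eigen_filtration a (shifted_euler c (shifted_euler c v)) ->
  eigen_filtration a (shifted_euler c v).
Proof.
have s0 := (eigen_filtration_stable a).1.
move=> /(eigen_annihilator c)[s cs]; set u := shifted_euler c v => Ns Nu.
elim: s cs Ns => //= k s IH; rewrite inE negb_or => /andP[ck cs].
rewrite (shifted_eulerB k c) -poly_eulerC => Ns; apply: IH => //.
have kc : k - c != 0 by rewrite subr_eq0 eq_sym.
rewrite -[poly_euler s u]scale1r -(mulVf kc) -scalerA; apply: subspaceZ => //.
by apply: subspace_addKl Ns => //; apply: poly_euler_filtration.
Qed.

Lemma eigen_filtration_euler_char a :
  alt_sum m.+1 (homology_dim (lower x) (-1) (chains_in (eigen_filtration a))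
    (chains_in [set 0])) =
  (-1) ^+ m * alt_sum m.+1 (homology_dim (lower d) (-1)
    (chains_in (eigen_filtration a)) (chains_in [set 0])).
Proof.
have w0 : weyl_stable [set 0] by rewrite -eigen_filtration0; apply: eigen_filtration_stable.
have e1 : (-1 : int) = 1 \/ (-1 : int) = -1 by right.
have sx N : weyl_stable N -> subcomplex (lower x) (-1) (chains_in N).
  by move=> [sN stN]; apply: (koszul_lower_subcomplex _ sN) => i v /(stN i)[].
have sd N : weyl_stable N -> subcomplex (lower d) (-1) (chains_in N).
  by move=> [sN stN]; apply: (koszul_lower_subcomplex _ sN) => i v /(stN i)[].
elim: a => [|a IH].
  rewrite eigen_filtration0.
  have z (f : 'I_m -> {linear V -> V}) : subcomplex (lower f) (-1) (chains_in [set 0]) ->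
      alt_sum m.+1 (homology_dim (lower f) (-1) (chains_in [set 0]) (chains_in [set 0])) = 0.
    move=> sf; rewrite /alt_sum big1 // => k _.
    rewrite /homology_dim (quot_dimE (d := 0%N)) ?mulr0 //.
    - exact: rel_cycles_subspace.
    - exact: rel_boundaries_subspace.
    - apply: has_quot_dim0; first exact: rel_boundaries_subspace.
      by move=> c [c0 _]; apply: rel_boundariesW.
  by rewrite !z ?mulr0 //; [apply: sd|apply: sx].
have sub0 : [set 0] `<=` eigen_filtration a.
  by move=> _ ->; apply: subspace0 (eigen_filtration_stable a).1.
have subS := @eigen_filtration_incr a.
have wS := eigen_filtration_stable a.+1; have wa := eigen_filtration_stable a.
have incl0 q : chains_in (V:=V) (m:=m) [set 0] q `<=` chains_in (eigen_filtration a) q.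
  exact: chains_in_sub.
have inclS q : chains_in (m:=m) (eigen_filtration a) q `<=` chains_in (eigen_filtration a.+1) q.
  exact: chains_in_sub.
have bd : bounded_pair m.+1 (chains_in (m:=m) (eigen_filtration a.+1)) (chains_in [set 0]).
  exact: chains_in_bounded w0.1.
have dK := koszul_lowerK charK0 [set: 'I_m]%SET dC.
have xK := koszul_lowerK charK0 [set: 'I_m]%SET xC.
rewrite (homology_euler_add xK e1 (sx _ wS) (sx _ wa) (sx _ w0) incl0 inclS bd);
  [|by move=> p; apply: (lower_x_fin wa w0 sub0)|by move=> p; apply: (lower_x_fin wS wa subS)].
rewrite (homology_euler_add dK e1 (sd _ wS) (sd _ wa) (sd _ w0) incl0 inclS bd);
  [|by move=> p; apply: (lower_d_fin wa w0 sub0)|by move=> p; apply: (lower_d_fin wS wa subS)].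
rewrite IH mulrDr; congr (_ + _); apply: pair_euler => //.
- exact: eigen_filtration_decomp.
- exact: eigen_filtration_reduced.
Qed.

End WeylModule.

(** * Modules over the Weyl algebra *)

Section WeylAction.
Variables (K : fieldType) (m : nat) (M : lmodType (weyl K m)).
Local Notation A := (weyl K m).
Local Notation MK := (as_Kspace M).

Lemma malgC_central (c : K) (g : free_alg K m) : g * c%:MP = c%:MP * g.
Proof.
rewrite mul_malgC malgM_def fgmulgU malgZ_def; apply: eq_bigr => k _.
by rewrite mulm1 mulrC.
Qed.

Lemma weyl_scalar_central (c : K) (g : A) :
  g * weyl_proj (c%:MP : free_alg K m) = weyl_proj (c%:MP : free_alg K m) * g.
Proof. by rewrite -[g]weyl_reprK -!weyl_projM malgC_central. Qed.

Lemma KscaleE (c : K) (v : MK) :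
  c *: v = weyl_proj (c%:MP : free_alg K m) *: (v : M).
Proof. by []. Qed.

Definition weyl_act (g : A) (v : MK) : MK := g *: (v : M).

Lemma weyl_act_linear g : linear (weyl_act g).
Proof.
move=> c u v; rewrite /weyl_act scalerDr !KscaleE; congr (_ + _).
by rewrite !scalerA weyl_scalar_central.
Qed.

HB.instance Definition _ g :=
  GRing.isLinear.Build K MK MK _ (weyl_act g) (weyl_act_linear g).

Definition actX (i : 'I_m) : {linear MK -> MK} := weyl_act (wX K i).
Definition actD (i : 'I_m) : {linear MK -> MK} := weyl_act (wD K i).

Lemma actXC i j v : actX i (actX j v) = actX j (actX i v).
Proof. by rewrite /actX /= /weyl_act !scalerA wXX. Qed.

Lemma actDC i j v : actD i (actD j v) = actD j (actD i v).
Proof. by rewrite /actD /= /weyl_act !scalerA wDD. Qed.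

Lemma actDX i j v : actD i (actX j v) = actX j (actD i v) + (i == j)%:R *: v.
Proof.
rewrite /actD /actX /= /weyl_act !scalerA.
have -> : wD K i * wX K j = wX K j * wD K i + (i == j)%:R.
  by rewrite -wDX addrC subrK.
rewrite scalerDl; congr (_ + _); by case: (i == j); rewrite ?scale0r ?scale1r.
Qed.

Lemma weyl_proj_mon (c : K) (w : seq (weyl_gen m)) :
  weyl_proj << c *g (FMonom w) >> = weyl_proj (c%:MP : free_alg K m) * wmon K w.
Proof.
have -> : << c *g (FMonom w) >> = c%:MP * << FMonom w >> :> free_alg K m.
  by rewrite malgM_def fgmulUU mulr1 mul1m.
rewrite weyl_projM; congr (_ * _); elim: w => [|g w IH].
  by rewrite /wmon big_nil -fmoneE rmorph1.
rewrite /wmon big_cons -/(wmon K w) -IH.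
have -> : << FMonom (g :: w) >> = << fmu g >> * << FMonom w >> :> free_alg K m.
  by rewrite malgM_def fgmulUU mulr1 fmuE; congr << _ >>; apply/eqP; rewrite fmP fmM.
by rewrite weyl_projM; case: g.
Qed.

Lemma weyl_act_stable (N : set MK) (g : A) v : is_subspace N ->
  (forall i u, N u -> N (actX i u) /\ N (actD i u)) -> N v -> N (weyl_act g v).
Proof.
move=> sN stN Nv; rewrite -[g]weyl_reprK [weyl_repr g]monalgE raddf_sum.
rewrite /weyl_act scaler_suml; apply: (@subspace_sum K MK N) => // k _.
have HH : weyl_proj << mcoeff k (weyl_repr g) *g k >> =
    weyl_proj ((mcoeff k (weyl_repr g))%:MP : free_alg K m) * wmon K k.
  by rewrite -weyl_proj_mon fmK.
rewrite /= HH -scalerA.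
apply: (@subspaceZ K MK N (mcoeff k (weyl_repr g))) => //.
elim: (k : seq _) => [|h w IH]; first by rewrite /wmon big_nil scale1r.
rewrite /wmon big_cons -scalerA.
by case: h => i; have [] := stN i _ IH.
Qed.

Lemma euler_act j (a : nat) (z : M) :
  (euler_op K m - j%:~R) ^+ a *: z = iter a (shifted_euler actX actD (- j%:~R)) (z : MK).
Proof.
have E (u : M) : (euler_op K m - j%:~R) *: u = shifted_euler actX actD (- j%:~R) (u : MK).
  rewrite /shifted_euler scalerBl scaler_suml scaleNr; congr (_ - _).
    by apply: eq_bigr => i _; rewrite -scalerA.
  rewrite KscaleE.
  have -> : weyl_proj ((j%:~R : K)%:MP : free_alg K m) = j%:~R by rewrite !rmorph_int.
  by [].
elim: a => [|a IH]; first by rewrite scale1r.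
by rewrite exprS -scalerA IH E.
Qed.

(** [koszul_diff] sums over the source sets; at a fixed target [T] and index [i], only the source
    [i |: T] contributes. *)
Lemma koszul_diffE (b : 'I_m -> A) (c : {ffun {set 'I_m} -> MK}) :
  koszul_diff b c = koszul_lower [set: 'I_m]%SET (fun i => weyl_act (b i) : {linear MK -> MK}) c.
Proof.
apply/ffunP => T; rewrite koszul_lowerE sum_ffunE.
under eq_bigr do rewrite sum_ffunE big_mkcond /=.
rewrite exchange_big [RHS]big_mkcond; apply: eq_bigr => i _; rewrite inE /=.
case: ifPn => iT.
  rewrite (bigD1 (i |: T)%SET) //= setU11 big1 ?addr0 => [|S Si].
    have sg : (-1 : K) ^+ #|[pred j in (i |: T)%SET | (j < i)%N]| = koszul_sign K i T.
      by apply: etrans (koszul_sign_add K i iT) _; rewrite ltnn mul1r.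
    by rewrite ffunE finset.setU1K // eqxx sg.
  case: ifPn => // iS; rewrite ffunE ifN //.
  by apply: contra_neq Si => ->; rewrite finset.setD1K.
rewrite big1 // => S _; case: ifPn => // iS; rewrite ffunE ifN //.
by apply: contraNneq iT => ->; rewrite setD11.
Qed.

Lemma koszul_homology_dimE (b : 'I_m -> A) (p : nat) :
  koszul_homology_dim b M p =
  homology_dim (koszul_lower [set: 'I_m]%SET (fun i => weyl_act (b i) : {linear MK -> MK}))
    (-1) (chains_in setT) (chains_in [set 0]) p.
Proof.
have degE q : chain_of_degree q = chains_in (V := MK) (m := m) setT q.
  apply/seteqP; split=> c; first by move=> dc; split=> // T /dc ->.
  by move=> [_ dc] T /dc [].
have in0 q (c : {ffun {set 'I_m} -> MK}) : chains_in [set 0] q c <-> c = 0.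
  split=> [[c0 _]|->]; first by apply/ffunP => T; rewrite ffunE; apply: c0.
  by split=> T; rewrite ffunE ?eqxx.
rewrite /koszul_homology_dim /homology_dim; congr quot_dim; apply/seteqP; split=> c.
- move=> [dc c0]; split; first by rewrite -degE.
  by apply/in0; rewrite /= -koszul_diffE.
- by move=> [dc /in0 c0]; split; [rewrite degE|rewrite koszul_diffE].
- move=> [u du ->]; exists 0, u; rewrite add0r opprK; split; first exact/in0.
    by move: du; rewrite degE -addn1 PoszD.
  exact: koszul_diffE.
- move=> [w [u [/in0 -> du ->]]]; rewrite opprK in du; exists u.
    by rewrite degE -addn1 PoszD.
  by rewrite add0r koszul_diffE.
Qed.

Lemma koszul_euler_charE (b : 'I_m -> A) :
  koszul_euler_char b M =
  alt_sum m.+1 (homology_dim (koszul_lower [set: 'I_m]%SET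
    (fun i => weyl_act (b i) : {linear MK -> MK})) (-1) (chains_in setT) (chains_in [set 0])).
Proof. by apply: eq_bigr => p _; rewrite koszul_homology_dimE. Qed.

Lemma chi_XE : chi_X M = alt_sum m.+1
  (homology_dim (koszul_lower [set: 'I_m]%SET actX) (-1) (chains_in setT) (chains_in [set 0])).
Proof. exact: koszul_euler_charE. Qed.

Lemma chi_partialE : chi_partial M = alt_sum m.+1
  (homology_dim (koszul_lower [set: 'I_m]%SET actD) (-1) (chains_in setT) (chains_in [set 0])).
Proof. exact: koszul_euler_charE. Qed.

End WeylAction.

(** * The growth bound of a holonomic module and the exhaustion by eigenspaces *)

Section Holonomic.
Variables (K : fieldType) (m : nat) (M : lmodType (weyl K m)).
Local Notation MK := (as_Kspace M).

(** The constant bounds the sum of the absolute values of the coefficients. Using k+1 instead of k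
    makes powers increase with the exponent even at k = 0. *)
Lemma poly_growth (p : {poly rat}) : size p = m.+1 ->
  exists C : nat, forall k : nat, p.[k%:R] <= (C * k.+1 ^ m)%N%:R.
Proof.
move=> sp; pose S := \sum_(i < m.+1) `|p`_i|.
have S0 : 0 <= S by apply: sumr_ge0.
exists (Num.bound S) => k; rewrite horner_coef sp natrM.
apply: (@le_trans _ _ (S * (k.+1 ^ m)%N%:R)); last first.
  by apply: ler_wpM2r; rewrite ?ler0n // ltW // archi_boundP.
rewrite mulr_suml; apply: ler_sum => i _; apply: le_trans (ler_norm _) _.
rewrite normrM; apply: ler_wpM2l => //.
rewrite ger0_norm ?exprn_ge0 ?ler0n // -natrX ler_nat.
apply: (@leq_trans (k.+1 ^ i)%N).
  by case: (posnP i) => i0; rewrite ?i0 // leq_exp2r.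
by rewrite leq_pexp2l // -ltnS.
Qed.

Lemma holonomic_growth : holonomic M -> exists F : nat -> set MK, exists C : nat,
  [/\ forall k, is_subspace (F k), forall k, F k `<=` F k.+1,
      forall v, exists k, F k v,
      forall i k v, F k v -> F k.+1 (actX M i v) /\ F k.+1 (actD M i v) &
      growth_bounded F setT [set 0] C m].
Proof.
case=> _ [M0|[F [gF [p [sp [k0 Fp]]]]]].
  exists (fun _ => setT), 0%N; split=> // k r e _ ie.
  rewrite leqNgt; apply/negP; case: r e ie => // r e ie _.
  have /rowP/(_ 0) := ie (const_mx 1) (M0 _).
  by rewrite !mxE => /eqP; rewrite oner_eq0.
have [C HC] := poly_growth sp.
have Fsub k := filtration_subspace gF k.
have Fincr := filtration_incr gF.
(* The Hilbert polynomial is valid from [k0] on only, so smaller [k] are treated inside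
   [F (maxn k0 k)]; the factor comes from max(k0, k) + 1 <= (k0 + 1)(k + 1). *)
exists F, (C * k0.+1 ^ m)%N; split=> //.
- exact: filtration_exhaust gF.
- move=> i k v Fv; rewrite -add1n; split; apply: (filtration_act gF) => //;
    apply: Kspan_incl.
    by exists [:: inl i] => //; rewrite /wmon big_seq1.
  by exists [:: inr i] => //; rewrite /wmon big_seq1.
move=> k r e Fe ie.
have FK : F k `<=` F (maxn k0 k) by apply: (F_mono Fincr); apply: leq_maxr.
have rK : (r <= Kdim (F (maxn k0 k)))%N.
  have fF := filtration_fin_dim gF (maxn k0 k).
  have s0 := subspace_set0 MK.
  apply: (has_quot_dim_bounded (Fsub _) s0 (fin_quotP (Fsub _) s0 fF)) ie => i.
  by apply: FK; case: (Fe i).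
apply: leq_trans rK _.
have := HC (maxn k0 k); rewrite -Fp ?leq_maxl // ler_nat => h.
apply: leq_trans h _; rewrite -mulnA leq_mul2l -expnMn; apply/orP; right.
case: (m) => // m'; rewrite leq_exp2r //.
by rewrite /maxn; case: ifP => _; nia.
Qed.

(** Every homogeneous component lies in some step, hence finitely many generators lie in a common
    one, and each step is a submodule. *)
Lemma eulerian_filtration (G : int -> set MK) :
  is_grading G -> finitely_generated M -> generalized_eulerian G ->
  exists a, eigen_filtration (actX M) (actD M) a = setT.
Proof.
move=> gr [r [g gen]] eul.
pose N := eigen_filtration (actX M) (actD M).
have stN a := eigen_filtration_stable (@actXC K m M) (@actDC K m M) (@actDX K m M) a.
have Nmono a b : (a <= b)%N -> N a `<=` N b.
  by apply: F_mono; apply: eigen_filtration_incr.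
have Nex (v : MK) : exists a, N a v.
  have [s [c [Gc ->]]] := grading_span gr v.
  elim: s => [|j s [a Na]].
    by exists 0%N; rewrite big_nil; apply: subspace0; case: (stN 0%N).
  have [b _ cj] := eul j (c j) (Gc j).
  exists (maxn a b); rewrite big_cons; apply: subspaceD.
  - by case: (stN (maxn a b)).
  - apply: (Nmono b); first exact: leq_maxr.
    by apply: Kspan_incl; exists (- j%:~R); rewrite -euler_act.
  - by apply: (Nmono a) Na; apply: leq_maxl.
have /choice[f Hf] := fun i => Nex (g i).
exists (\max_i f i)%N; apply/seteqP; split=> // v _.
have [a ->] := gen v; have [sN stNi] := stN (\max_i f i)%N.
apply: (@subspace_sum K MK (N (\max_i f i)%N)) => // i _.
apply: (weyl_act_stable (a i) sN stNi).
by apply: (Nmono (f i)) (Hf i); apply: leq_bigmax.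
Qed.

End Holonomic.


Theorem theorem4p1 (K : fieldType) (charK0 : [pchar K] =i pred0) (n : nat)
    (M : lmodType (weyl K n.+1)) (G : int -> set (as_Kspace M))
    (gradedM : is_grading G) (holM : holonomic M)
    (eulerM : generalized_eulerian G) :
  chi_partial M = (-1) ^+ n.+1 * chi_X M.
Proof.
have [F [C [sF Fincr Fex Fact Fgrowth]]] := holonomic_growth holM.
have [a Na] := eulerian_filtration gradedM holM.1 eulerM.
have XF i k v : F k v -> F k.+1 (actX M i v) by case/(Fact i).
have DF i k v : F k v -> F k.+1 (actD M i v) by case/(Fact i).
(* [eigen_filtration_euler_char] expresses the Euler characteristic for [X] by the one for the
   derivations; the sign is its own inverse. *)
have sgn_swap (u v : int) : u = (-1) ^+ n.+1 * v -> v = (-1) ^+ n.+1 * u.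
  by move=> ->; rewrite mulrA -exprD addnn -signr_odd odd_double mul1r.
have E := eigen_filtration_euler_char charK0 Fincr Fex (@actXC K n.+1 M)
  (@actDC K n.+1 M) (@actDX K n.+1 M) XF DF sF Fgrowth a.
rewrite Na in E.
exact: etrans (chi_partialE M) (etrans (sgn_swap _ _ E) (congr1 _ (esym (chi_XE M)))).
Qed.
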